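(* A Banach space $X$ has the Lebesgue property if and only if every normalized basic sequence $(e_i)$ in $X$ is a Haar-$\ell_1^+$ sequence.
   Context: $\mathbb{N}=\{1,2,3,\dots\}$. Riemann integrability. A partition of $[0,1]$ is a finite strictly increasing sequence $P=(p_i)_{i=0}^d$ with $p_0=0$, $p_d=1$; its mesh is $\pi(P)=\max_{1\le i\le d}(p_i-p_{i-1})$. A tagged partition is a pair $(P,T)$ with $T=(t_i)_{i=1}^d$ and $t_i\in[p_{i-1},p_i]$. For $f:[0,1]\to X$ put $S_f(P,T)=\sum_{i=1}^d (p_i-p_{i-1})f(t_i)$. The function $f$ is Riemann-integrable if there is $x_f\in X$ such that for every $\varepsilon>0$ there is $\delta>0$ with $\|x_f-S_f(P,T)\|<\varepsilon$ for every tagged partition $(P,T)$ with $\pi(P)<\delta$. Lebesgue property. $X$ has the Lebesgue property if every Riemann-integrable function $f:[0,1]\to X$ is continuous at Lebesgue almost every point of $[0,1]$. Basic sequence. A sequence $(e_i)_{i\in\mathbb{N}}$ in $X$ is basic if it is a Schauder basis of its closed linear span; it is normalized if $\|e_i\|=1$ for all $i$. Haar system of partitions. A collection $(A^n_j)_{n\in\mathbb{N},\,0\le j\le 2^n-1}$ of infinite subsets of $\mathbb{N}$ is a Haar system of partitions of $\mathbb{N}$ if (1) for every $n\in\mathbb{N}$, $\bigcup_{j=0}^{2^n-1}A^n_j=\mathbb{N}$ and $A^n_j\cap A^n_{j'}=\emptyset$ for $j\neq j'$; (2) for every $n\in\mathbb{N}$ and $0\le j\le 2^n-1$, $A^n_j=A^{n+1}_{2j}\cup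 A^{n+1}_{2j+1}$. Haar-$\ell_1^+$ sequence. A normalized basic sequence $(e_i)$ is a Haar-$\ell_1^+$ sequence if for every Haar system of partitions $(A^n_j)$ of $\mathbb{N}$ there exists a constant $C\ge 1$ such that $$\frac1C\le \lim_{n\to\infty}\sup\left\{\frac{1}{2^m}\left\|\sum_{j=0}^{2^m-1}e_{i_j}\right\| : m\ge n \text{ and } 2^m\le i_j\in A^m_j \text{ for } 0\le j\le 2^m-1\right\}.$$ *)

(* Defs.v *)
From mathcomp Require Export all_boot all_order all_algebra.
From mathcomp Require Export all_classical all_reals all_analysis.

Set Implicit Arguments.
Unset Strict Implicit.
Unset Printing Implicit Defensive.

Export Order.TTheory GRing.Theory Num.Theory.
Export numFieldNormedType.Exports.

Local Open Scope classical_set_scope.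
Local Open Scope ring_scope.

(* The partition p_0 < p_1 < ... < p_d of [0, 1] is encoded by the sequence
   s = [:: p_1; ...; p_d] with [itv_partition 0 1 s]; since p_0 = 0, the point
   p_i is [nth 0 (0 :: s) i] for i <= d. The tags [t_1; ...; t_d] are listed in
   a sequence t. Sequence positions are 0-based, so the i-th cell below is
   [p_i, p_(i+1)], of tag t_(i+1). *)
Definition cell_length (R : realType) (s : seq R) (i : nat) : R :=
  (0 :: s)`_i.+1 - (0 :: s)`_i.

Definition mesh (R : realType) (s : seq R) : R :=
  \big[Num.max/0]_(i < size s) cell_length s i.

Definition tagged_partition (R : realType) (s t : seq R) : Prop :=
  [/\ itv_partition 0 1 s, size t = size s &
      forall i, (i < size s)%N -> (0 :: s)`_i <= t`_i <= (0 :: s)`_i.+1].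

Definition riemann_sum (R : realType) (X : normedModType R) (f : R -> X)
    (s t : seq R) : X :=
  \sum_(i < size s) cell_length s i *: f t`_i.

(* Functions [0, 1] -> X are represented by total functions on R; the values
   outside [0, 1] play no role, here and in [lebesgue_property]. *)
Definition riemann_integrable (R : realType) (X : normedModType R)
    (f : R -> X) : Prop :=
  exists x : X, forall eps : R, 0 < eps -> exists2 delta : R, 0 < delta &
    forall s t : seq R, tagged_partition s t -> mesh s < delta ->
      `|x - riemann_sum f s t| < eps.

Definition lebesgue_property (R : realType) (X : normedModType R) : Prop :=
  forall f : R -> X, riemann_integrable f ->
    {ae @lebesgue_measure R, forall t : R, `[0, 1]%classic t ->
      f u @[u --> within `[0, 1]%classic (nbhs t)] --> f t}.

(* Sequences are indexed by {1, 2, 3, ...}: in all that follows, the term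
   [e 0] of a sequence e : nat -> X (and the coefficient [a 0]) is ignored. *)
Definition linear_span (R : realType) (X : normedModType R) (S : set X) :
    set X :=
  [set x | exists (n : nat) (c : 'I_n -> R) (v : 'I_n -> X),
    (forall k, S (v k)) /\ x = \sum_(k < n) c k *: v k].

Definition has_expansion (R : realType) (X : normedModType R) (e : nat -> X)
    (a : nat -> R) (x : X) : Prop :=
  \sum_(1 <= i < n) a i *: e i @[n --> \oo] --> x.

Definition schauder_basis (R : realType) (X : normedModType R) (Y : set X)
    (e : nat -> X) : Prop :=
  (forall i, (1 <= i)%N -> Y (e i)) /\
  forall y, Y y -> exists2 a : nat -> R, has_expansion e a y &
    forall b : nat -> R, has_expansion e b y ->
      forall i, (1 <= i)%N -> b i = a i.

Definition basic_sequence (R : realType) (X : normedModType R)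
    (e : nat -> X) : Prop :=
  schauder_basis (closure (linear_span [set e i | i in [set i | (1 <= i)%N]])) e.

Definition normalized (R : realType) (X : normedModType R)
    (e : nat -> X) : Prop :=
  forall i, (1 <= i)%N -> `|e i| = 1.

(* Only the sets [A n j] with 1 <= n and j < 2 ^ n are relevant. *)
Definition haar_system (A : nat -> nat -> set nat) : Prop :=
  forall n, (1 <= n)%N ->
  [/\ forall j, (j < 2 ^ n)%N -> infinite_set (A n j),
      \bigcup_(j in [set j | (j < 2 ^ n)%N]) A n j = [set i | (1 <= i)%N],
      forall j k, (j < 2 ^ n)%N -> (k < 2 ^ n)%N -> j <> k ->
        A n j `&` A n k = set0 &
      forall j, (j < 2 ^ n)%N ->
        A n j = A n.+1 (2 * j)%N `|` A n.+1 (2 * j).+1].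

Definition haar_averages (R : realType) (X : normedModType R) (e : nat -> X)
    (A : nat -> nat -> set nat) (n : nat) : set R :=
  [set r | exists (m : nat) (i : nat -> nat),
    [/\ (n <= m)%N,
        forall j, (j < 2 ^ m)%N -> (2 ^ m <= i j)%N /\ A m j (i j) &
        r = (2 ^+ m)^-1 * `|\sum_(0 <= j < 2 ^ m) e (i j)|]].

(* For e normalized and A a Haar system, [haar_averages e A n] is a nonempty
   subset of [0, 1] for n >= 1, and it decreases with n; so the real-valued
   [sup] and [limn] below are the genuine supremum and limit. *)
Definition haar_l1_plus (R : realType) (X : normedModType R)
    (e : nat -> X) : Prop :=
  [/\ normalized e, basic_sequence e &
      forall A : nat -> nat -> set nat, haar_system A ->
        exists2 C : R, 1 <= C & C^-1 <= limn (fun n => sup (haar_averages e A n))].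

(* Main.v *)
Require Import Defs.
From mathcomp Require Import ring lra zify.

(** If [e] is basic with projections bounded by [K] and the averages along some
    Haar system [A] tend to 0, put the vector [e i] at a point [tag i] lying in
    the dyadic interval of [i] at every level [m] with [2 ^ m <= i], and 0 at all
    other points. The resulting function is nowhere continuous. Its Riemann
    sums are, up to few small cells, [2 ^ -m] times sums over [j < 2 ^ m] of
    points of the convex hulls of [{0} `|` {e i | i \in A m j, 2 ^ m <= i}], so
    its integral is 0: zeros are harmless because the missing indices can be
    filled in with far ones and then be projected away.

    Conversely, if [f] is Riemann integrable and not a.e. continuous, its
    oscillation is at least some [d > 0] on a set of positive measure. Splitting
    this set dyadically according to its measure, one attaches to the [i]-th
    dyadic interval the normalized difference [e i] of two values of [f] at
    points close to each other. Averages of such differences over disjoint small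
    cells tend to 0 by integrability. The same fact and a pigeonhole argument
    show that each [e i] can be chosen so that adding its multiples
    hardly decreases the norm on the span of the previous ones, which makes [e]
    basic. *)

Set Implicit Arguments.
Unset Strict Implicit.
Unset Printing Implicit Defensive.

Local Open Scope classical_set_scope.
Local Open Scope ring_scope.

(** * Expansions and partial sums *)

Section Expansions.
Context {R : realType} {X : completeNormedModType R}.
Implicit Types (e : nat -> X) (a b : nat -> R).

Lemma cvg_seqP (V : normedModType R) (u : nat -> V) (l : V) :
  u n @[n --> \oo] --> l <->
  forall eps : R, 0 < eps -> exists N, forall n, (N <= n)%N -> `|l - u n| <= eps.
Proof.
split=> [/cvgrPdist_le ul eps /ul [N _ uN]|ul].
  by exists N => n /uN.
by apply/cvgrPdist_le => eps /ul [N uN]; exists N.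
Qed.

Lemma cauchy_seq_cvgn (V : completeNormedModType R) (u : nat -> V) :
  (forall eps : R, 0 < eps -> exists N, forall m n, (N <= m)%N -> (N <= n)%N ->
    `|u m - u n| <= eps) -> cvgn u.
Proof.
move=> cu; apply/cauchy_cvgP/cauchy_exP => eps eps0.
have [N uN] := cu _ (divr_gt0 eps0 (ltr0n _ 2)).
exists (u N); exists N => // n /= Nn; rewrite -ball_normE /=.
by rewrite (le_lt_trans (uN _ _ _ _))// gtr_pMr// invf_lt1 ?ltr1n.
Qed.

Lemma cvg_norm_le (V : normedModType R) (u : nat -> V) (l : V) (c : R) :
  u n @[n --> \oo] --> l ->
  (exists N, forall n, (N <= n)%N -> `|u n| <= c) -> `|l| <= c.
Proof.
move=> /cvg_seqP ul [N uN]; apply/ler_addgt0Pr => eps /ul [M uM].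
rewrite -[l](subrK (u (maxn N M))) addrC (le_trans (ler_normD _ _))// lerD//.
  by rewrite uN// leq_maxl.
by rewrite uM// leq_maxr.
Qed.

Definition psum e a n : X := \sum_(1 <= i < n) a i *: e i.

Lemma psumS e a n : (1 <= n)%N -> psum e a n.+1 = psum e a n + a n *: e n.
Proof. by move=> n1; rewrite /psum big_nat_recr. Qed.

Lemma psumB e a b n : psum e (fun i => a i - b i) n = psum e a n - psum e b n.
Proof. by rewrite /psum -sumrB; apply: eq_bigr => i _; rewrite scalerBl. Qed.

Lemma psumZ e a c n : psum e (fun i => c * a i) n = c *: psum e a n.
Proof. by rewrite /psum scaler_sumr; apply: eq_bigr => i _; rewrite scalerA. Qed.

Lemma coef_psum e a i : normalized e -> (1 <= i)%N ->
  `|a i| = `|psum e a i.+1 - psum e a i|.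
Proof. by move=> ne i1; rewrite psumS// addrC addKr normrZ ne// mulr1. Qed.

(** Each coefficient has the norm of a difference of two consecutive partial sums, so it converges;
    the uniform Cauchy condition then lets the limits in [k] and [n] be exchanged. *)
Lemma expansion_limit e (b : nat -> nat -> R) (y : nat -> X) (y0 : X) :
  normalized e -> y k @[k --> \oo] --> y0 ->
  (forall k, has_expansion e (b k) (y k)) ->
  (forall eps : R, 0 < eps -> exists N, forall k l, (N <= k)%N -> (N <= l)%N ->
    forall n, `|psum e (b k) n - psum e (b l) n| <= eps) ->
  exists2 a, has_expansion e a y0 &
    forall n, psum e (b k) n @[k --> \oo] --> psum e a n.
Proof.
move=> ne /cvg_seqP yy0 exb cb.
pose a i := limn (fun k => b k i).
have ba i : (1 <= i)%N -> b k i @[k --> \oo] --> a i.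
  move=> i1; apply: cauchy_seq_cvgn => eps eps0.
  have [N bN] := cb _ (divr_gt0 eps0 (ltr0n _ 2)).
  exists N => k l Nk Nl.
  rewrite (@coef_psum e (fun i => b k i - b l i))// !psumB.
  rewrite (le_trans (ler_normB _ _))// [leRHS](splitr eps).
  by rewrite lerD// bN.
have sa n : psum e (b k) n @[k --> \oo] --> psum e a n.
  case: n => [|n].
    rewrite /psum; under eq_fun do rewrite big_geq//.
    by rewrite big_geq//; exact: cvg_cst.
  elim: n => [|n IH].
    rewrite /psum; under eq_fun do rewrite big_geq//.
    by rewrite big_geq//; exact: cvg_cst.
  rewrite psumS//; under eq_fun do rewrite psumS//.
  by apply: cvgD => //; apply: cvgZr_tmp; apply: ba.
exists a => //; apply/cvg_seqP => eps eps0.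
have e3 : 0 < eps / 3 by rewrite divr_gt0.
have [N bN] := cb _ e3.
have [N' yN'] := yy0 _ e3.
pose k := maxn N N'.
have /cvg_seqP/(_ _ e3)[M bM] := exb k.
exists M => n Mn.
have -> : eps = eps / 3 + (eps / 3 + eps / 3) by field.
rewrite (le_trans (ler_distD (y k) _ _))// lerD//.
  by rewrite yN'// leq_maxr.
rewrite (le_trans (ler_distD (psum e (b k) n) _ _))// lerD//; first exact: bM.
apply: (@cvg_norm_le _ (fun l => psum e (b k) n - psum e (b l) n)).
  by apply: cvgB => //; apply: cvg_cst.
by exists N => l Nl; apply: bN => //; exact: leq_maxl.
Qed.

Lemma psum_stationary e a m n : (forall i, (m <= i)%N -> a i = 0) ->
  (m <= n)%N -> psum e a n = psum e a m.
Proof.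
move=> a0 mn; rewrite -(subnKC mn); elim: (n - m)%N => [|k IH].
  by rewrite addn0.
rewrite addnS -IH; case: (posnP (m + k)) => [->|mk0].
  by rewrite /psum !big_geq.
by rewrite psumS// a0 ?leq_addr// scale0r addr0.
Qed.

Lemma has_expansion_stationary e a m :
  (forall i, (m <= i)%N -> a i = 0) -> has_expansion e a (psum e a m).
Proof.
move=> a0; apply/cvg_seqP => eps eps0; exists m => n mn.
by rewrite [X in _ - X](psum_stationary _ a0 mn) subrr normr0 ltW.
Qed.

Lemma closureP (V : normedModType R) (S : set V) (x : V) :
  closure S x <-> forall eps : R, 0 < eps -> exists2 y, S y & `|x - y| < eps.
Proof.
split=> [Sx eps eps0|Sx B].
  have [y [Sy]] := Sx _ (nbhsx_ballx x eps eps0).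
  by rewrite -ball_normE => xy; exists y.
move=> /nbhs_ballP[eps /= eps0 xB]; have [y Sy xy] := Sx _ eps0.
by exists y; split=> //; apply: xB; rewrite -ball_normE.
Qed.

Lemma linear_span_psum e x : linear_span [set e i | i in [set i | (1 <= i)%N]] x ->
  exists a m, x = psum e a m /\ forall i, (m <= i)%N -> a i = 0.
Proof.
move=> [n [c [v [vS ->]]]].
have /choice[g gP] : forall k, exists i, (1 <= i)%N /\ e i = v k.
  by move=> k; have [i i1 <-] := vS k; exists i.
(* Several [v k] may have the same index; the coefficient of [e i] collects them all. *)
exists (fun i => \sum_(k < n | g k == i) c k), (\max_(k < n) g k).+1; split.
  rewrite /psum; under [RHS]eq_bigr do rewrite scaler_suml.
  rewrite [RHS](exchange_big_dep xpredT)//=; apply: eq_bigr => k _.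
  rewrite big_mkcond/= (bigD1_seq (g k)) ?iota_uniq//=; last first.
    by rewrite mem_index_iota (gP k).1 ltnS leq_bigmax.
  rewrite eqxx (gP k).2 big1 ?addr0// => i /negPf.
  by rewrite eq_sym => ->.
move=> i mi; rewrite big1// => k /eqP gk.
by move: mi; rewrite -gk ltnNge leq_bigmax.
Qed.

Lemma psum_span e a n :
  linear_span [set e i | i in [set i | (1 <= i)%N]] (psum e a n).
Proof.
case: n => [|n].
  exists 0%N, (fun=> 0), (fun=> 0); split; first by case.
  by rewrite /psum big_geq// big_ord0.
exists n, (fun i => a i.+1), (fun i => e i.+1); split.
  by move=> k; exists k.+1.
by rewrite /psum big_add1/= big_mkord.
Qed.

(** Grunblum's criterion. The bound [K] makes the partial sums of approximants of [y] uniformly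
    Cauchy, so their expansions pass to the limit; for uniqueness, each partial sum of a difference
    of expansions is bounded by [K] times later ones, which tend to 0. *)
Lemma basic_sequence_of_projections e (K : R) : normalized e ->
  (forall a n m, (n <= m)%N -> `|psum e a n| <= K * `|psum e a m|) ->
  basic_sequence e.
Proof.
move=> ne eK; split=> [i i1|y /closureP Yy].
  apply: subset_closure; exists 1%N, (fun=> 1), (fun=> e i); split.
    by move=> _; exists i.
  by rewrite big_ord_recl big_ord0 addr0 scale1r.
have K0 : 0 <= K.
  have := eK (fun=> 1) 2%N 2%N isT.
  rewrite /psum big_nat1 scale1r ne// mulr1; exact: le_trans.
have K1 : 0 < K + 1 by rewrite ltr_wpDl.
have /choice[z zP] : forall k, exists z, exists a m,
    [/\ `|y - z| < k.+1%:R^-1, z = psum e a m &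
        forall i, (m <= i)%N -> a i = 0].
  move=> k; have [|z /linear_span_psum[a [m [za am]]] yz] := Yy k.+1%:R^-1.
    by rewrite invr_gt0.
  by exists z, a, m.
have /choice[b bP] : forall k, exists a, exists m, 
    [/\ `|y - z k| < k.+1%:R^-1, z k = psum e a m &
        forall i, (m <= i)%N -> a i = 0] by move=> k; have := zP k.
have exb k : has_expansion e (b k) (z k).
  by have [m [_ -> /has_expansion_stationary]] := bP k.
have zy : z k @[k --> \oo] --> y.
  apply/cvg_seqP => eps eps0.
  exists (Num.truncn eps^-1) => n Nn.
  have [m [/ltW yz _ _]] := bP n; rewrite (le_trans yz)//.
  rewrite invf_ple ?posrE//; apply: ltW.
  by rewrite (lt_le_trans (truncnS_gt _))// ler_nat.
have bz k l n : `|psum e (b k) n - psum e (b l) n| <= K * `|z k - z l|.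
  have [m [_ zk bk]] := bP k; have [m' [_ zl bl]] := bP l.
  pose M := maxn n (maxn m m').
  have {}zk : z k = psum e (b k) M.
    by rewrite (psum_stationary _ bk)// !leq_max leqnn orbT.
  have {}zl : z l = psum e (b l) M.
    by rewrite (psum_stationary _ bl)// !leq_max leqnn !orbT.
  by rewrite zk zl -!psumB; apply: eK; exact: leq_maxl.
have [|a ya _] := expansion_limit ne zy exb.
  move=> eps eps0; move/cvg_seqP : zy => /(_ (eps / 2 / (K + 1)))[].
    by rewrite !divr_gt0.
  move=> N zN; exists N => k l Nk Nl n.
  rewrite (le_trans (bz _ _ _))//.
  rewrite (@le_trans _ _ (K * (eps / (K + 1))))//; last first.
    by rewrite mulrCA ger_pMr// ler_pdivrMr// mul1r lerDl.
  rewrite ler_wpM2l// (le_trans (ler_distD y _ _))//.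
  have -> : eps / (K + 1) = eps / 2 / (K + 1) + eps / 2 / (K + 1).
    by rewrite -mulrDl -splitr.
  by rewrite lerD//; [rewrite distrC|]; apply: zN.
exists a => // c yc i i1.
have s0 n : psum e (fun i => c i - a i) n = 0.
  apply/eqP; rewrite -normr_le0.
  have : K * `|psum e (fun i => c i - a i) m| @[m --> \oo] --> K * `|y - y|.
    apply: cvgMl_tmp; apply: cvg_norm.
    rewrite (_ : psum e _ = fun m => psum e c m - psum e a m).
      exact: cvgB.
    by apply/funext => m; exact: psumB.
  rewrite subrr normr0 mulr0 => lim0; rewrite -(cvg_lim _ lim0)//.
  apply: limr_ge; first exact: cvgP lim0.
  by exists n => // m /= nm; exact: eK.
apply/eqP; rewrite -subr_eq0 -normr_eq0.
by rewrite (@coef_psum e (fun i => c i - a i))// !s0 subrr normr0.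
Qed.
End Expansions.

(** * The basis constant *)

Section BasisConstant.
Context {R : realType} {X : completeNormedModType R}.
Implicit Types (e : nat -> X) (a b : nat -> R).

Lemma geometric_dist (V : normedModType R) (u : nat -> V) (c : R) :
  (forall k, `|u k.+1 - u k| <= c / 2 ^+ k) ->
  forall k l, (k <= l)%N -> `|u l - u k| <= 2 * c / 2 ^+ k.
Proof.
move=> uc k l /subnKC <-; set d := (l - k)%N.
have c0 : 0 <= c by have := le_trans (normr_ge0 _) (uc 0%N); rewrite expr0 divr1.
(* The subtracted term is the geometric tail from [k + d] on; with it the induction closes. *)
suff /le_trans : `|u (k + d)%N - u k| <= 2 * c / 2 ^+ k - 2 * c / 2 ^+ (k + d).
  by apply; rewrite gerBl divr_ge0 ?mulr_ge0 ?exprn_ge0.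
elim: d => [|d IH]; first by rewrite addn0 !subrr normr0.
rewrite addnS (le_trans (ler_distD (u (k + d)%N) _ _))//.
rewrite (le_trans (lerD (uc _) IH))// exprS.
have : 2 ^+ (k + d) != 0 :> R by rewrite expf_neq0.
set p := 2 ^+ (k + d) => p0.
by rewrite le_eqVlt; apply/orP; left; apply/eqP; field; rewrite p0 expf_neq0.
Qed.

Lemma geometric_small (c eps : R) : 0 < eps -> exists N, forall n, (N <= n)%N ->
  c / 2 ^+ n <= eps.
Proof.
move=> eps0; exists (Num.truncn (`|c| / eps)) => n Nn.
rewrite ler_pdivrMr ?exprn_gt0// (le_trans (ler_norm _))//.
rewrite mulrC -ler_pdivrMr// (le_trans (ltW (truncnS_gt _)))//.
rewrite -natrX ler_nat (leq_ltn_trans Nn)//; exact: ltn_expl.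
Qed.

Notation closed_span e := (closure (linear_span [set e i | i in [set i | (1 <= i)%N]])).

Lemma linear_span_lin (V : normedModType R) (S : set V) (c : R) x y :
  linear_span S x -> linear_span S y -> linear_span S (x + c *: y).
Proof.
move=> [n [a [v [vS ->]]]] [m [b [w [wS ->]]]].
exists (n + m)%N,
  (fun k => match fintype.split k with inl i => a i | inr j => c * b j end),
  (fun k => match fintype.split k with inl i => v i | inr j => w j end); split.
  by move=> k; case: fintype.split.
rewrite big_split_ord/= scaler_sumr; congr +%R; apply: eq_bigr => i _.
  by rewrite -[lshift _ _]/(unsplit (inl i)) unsplitK.
by rewrite -[rshift _ _]/(unsplit (inr i)) unsplitK scalerA.
Qed.

Lemma closed_span_lin (V : normedModType R) (S : set V) (c : R) x y :
  closure (linear_span S) x -> closure (linear_span S) y ->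
  closure (linear_span S) (x + c *: y).
Proof.
move=> /closureP Sx /closureP Sy; apply/closureP => eps eps0.
have c0 : 0 < `|c| + 1 by rewrite ltr_wpDl.
have [x' Sx' xx'] := Sx _ (divr_gt0 eps0 (ltr0n _ 2)).
have [y' Sy' yy'] := Sy _ (divr_gt0 (divr_gt0 eps0 (ltr0n _ 2)) c0).
exists (x' + c *: y'); first exact: linear_span_lin.
rewrite opprD addrACA -scalerBr [ltRHS](splitr eps).
rewrite (le_lt_trans (ler_normD _ _))// ltr_leD// normrZ.
rewrite (@le_trans _ _ ((`|c| + 1) * `|y - y'|))//.
  by rewrite ler_wpM2r// lerDl.
by rewrite mulrC -ler_pdivlMr// ltW.
Qed.

(** For [c] a natural number, these sets cover the closed span of a basic sequence; Baire's argument
    is applied to them. *)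
Definition bounded_expansion e (c : R) (y : X) : Prop :=
  exists2 a, has_expansion e a y & forall n, `|psum e a n| <= c.

Lemma has_expansion_span e a y : has_expansion e a y -> closed_span e y.
Proof.
move=> /cvg_seqP ay; apply/closureP => eps eps0.
have [N aN] := ay _ (divr_gt0 eps0 (ltr0n _ 2)).
exists (psum e a N); first exact: psum_span.
by rewrite (le_lt_trans (aN _ _))// gtr_pMr// invf_lt1 ?ltr1n.
Qed.

Lemma psum_lin e a b (c : R) n :
  psum e (fun i => a i + c * b i) n = psum e a n + c *: psum e b n.
Proof.
rewrite scaler_sumr -big_split/=.
by apply: eq_bigr => i _; rewrite scalerDl scalerA.
Qed.

Lemma has_expansion_lin e a b y z (c : R) : has_expansion e a y ->
  has_expansion e b z -> has_expansion e (fun i => a i + c * b i) (y + c *: z).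
Proof.
move=> ay bz; rewrite /has_expansion.
rewrite (_ : (fun n => _) = fun n => psum e a n + c *: psum e b n).
  by apply: cvgD => //; exact: cvgZl_tmp.
by apply/funext => n; exact: psum_lin.
Qed.

Lemma bounded_expansion_lin e (c c' k : R) y z : bounded_expansion e c y ->
  bounded_expansion e c' z -> bounded_expansion e (c + `|k| * c') (y + k *: z).
Proof.
move=> [a ay ac] [b bz bc]; exists (fun i => a i + k * b i).
  exact: has_expansion_lin.
move=> n; rewrite psum_lin (le_trans (ler_normD _ _))// lerD// normrZ.
by rewrite ler_wpM2l.
Qed.

Lemma bounded_expansion0 e : bounded_expansion e 0 0.
Proof.
have p0 n : psum e (fun=> 0) n = 0.
  by rewrite /psum big1// => i _; rewrite scale0r.
exists (fun=> 0) => [|n]; last by rewrite p0 normr0.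
apply/cvg_seqP => eps eps0; exists 0%N => n _.
by rewrite [X in _ - X]p0 subrr normr0 ltW.
Qed.

Lemma bounded_expansion_le e (c c' : R) y : c <= c' ->
  bounded_expansion e c y -> bounded_expansion e c' y.
Proof. by move=> cc' [a ay ac]; exists a => // n; exact: le_trans cc'. Qed.

Lemma has_expansion_bounded e a y : has_expansion e a y ->
  exists N : nat, bounded_expansion e N%:R y.
Proof.
move=> ay; have /cvg_seqP/(_ _ ltr01)[N aN] := ay.
pose c := `|y| + 1 + \sum_(n < N) `|psum e a n|.
exists (Num.truncn c).+1, a => // n; apply: ltW.
apply: le_lt_trans (truncnS_gt _); rewrite /c.
have [nN|Nn] := ltnP n N.
  rewrite (bigD1 (Ordinal nN))//= addrCA lerDl addr_ge0 ?addr_ge0//.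
  exact: sumr_ge0.
rewrite -[leLHS]addr0 lerD//; last exact: sumr_ge0.
rewrite -[psum e a n](subKr y) (le_trans (ler_normB _ _))// lerD//.
exact: aN.
Qed.

(* Baire's theorem in the closed span, which is not a type of its own. *)
Lemma expansion_category e : basic_sequence e -> exists (N : nat) (r : R) (y0 : X),
  [/\ 0 < r, closed_span e y0 & forall y, closed_span e y -> `|y - y0| < r ->
      closure (bounded_expansion e N%:R) y].
Proof.
move=> [_ be]; apply: contrapT => nB.
(* A state is a ball, given by centre and radius; stage [n] shrinks it to a ball that avoids all
   vectors with an expansion bounded by [n]. *)
have step n (p : X * R) : exists q : X * R, closed_span e p.1 /\ 0 < p.2 ->
    [/\ closed_span e q.1, 0 < q.2, `|q.1 - p.1| <= p.2 / 2, q.2 <= p.2 / 2 &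
        forall z, bounded_expansion e n%:R z -> q.2 < `|q.1 - z|].
  have [[Yp p0]|np] := pselect (closed_span e p.1 /\ 0 < p.2); last by exists p.
  have [y [Yy yp ny]] : exists y, [/\ closed_span e y, `|y - p.1| < p.2 / 2 &
      ~ closure (bounded_expansion e n%:R) y].
    apply: contrapT => ney; apply: nB; exists n, (p.2 / 2), p.1; split => //.
      by rewrite divr_gt0.
    by move=> y Yy yp; apply: contrapT => ny; apply: ney; exists y.
  have [rho rho0 yrho] : exists2 rho : R, 0 < rho &
      forall z, bounded_expansion e n%:R z -> rho <= `|y - z|.
    apply: contrapT => nrho; apply: ny; apply/closureP => eps eps0.
    apply: contrapT => nz; apply: nrho; exists eps => // z Bz.
    by rewrite leNgt; apply/negP => yz; apply: nz; exists z.
  exists (y, Num.min (p.2 / 2) (rho / 2)) => _; split => //=.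
  - by rewrite lt_min !divr_gt0.
  - exact: ltW.
  - by rewrite ge_min lexx.
  - move=> z /yrho; apply: lt_le_trans.
    by rewrite gt_min gtr_pMr// invf_lt1 ?ltr1n// orbT.
pose g n p := projT1 (cid (step n p)).
pose fix s n : X * R := if n is m.+1 then g m (s m) else (0, 1).
have sP n : closed_span e (s n).1 /\ 0 < (s n).2.
  elim: n => [|n IH] /=; last by rewrite /g; case: cid => q /= /(_ IH)[].
  split => //; apply: subset_closure.
  exists 0%N, (fun=> 0), (fun=> 0); split; first by case.
  by rewrite big_ord0.
have gP n : [/\ closed_span e (s n.+1).1, 0 < (s n.+1).2,
    `|(s n.+1).1 - (s n).1| <= (s n).2 / 2, (s n.+1).2 <= (s n).2 / 2 &
    forall z, bounded_expansion e n%:R z -> (s n.+1).2 < `|(s n.+1).1 - z|].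
  by rewrite /= /g; case: cid => q /= /(_ (sP n)).
have rn n : (s n).2 <= 1 / 2 ^+ n.
  elim: n => [|n IH]; first by rewrite expr0 divr1.
  have [_ _ _ /le_trans + _] := gP n; apply.
  by rewrite exprSr invfM mulrA ler_wpM2r.
have sdist d k : `|(s (k + d)%N).1 - (s k).1| <= (s k).2.
  elim: d k => [|d IH] k; first by rewrite addn0 subrr normr0 ltW// (sP k).2.
  rewrite addnS -addSn (le_trans (ler_distD (s k.+1).1 _ _))//.
  have [_ _ dk rk _] := gP k.
  by rewrite [leRHS]splitr lerD// (le_trans (IH _)).
pose u n : X := (s n).1.
have sy : cvgn u.
  apply: cauchy_seq_cvgn => eps eps0.
  have [N Neps] := geometric_small 1 (divr_gt0 eps0 (ltr0n R 2)).
  have sN m : (N <= m)%N -> `|(s m).1 - (s N).1| <= eps / 2.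
    by move=> /subnKC <-; rewrite (le_trans (sdist _ _))// (le_trans (rn _))// Neps.
  exists N => m n Nm Nn; rewrite (le_trans (ler_distD (s N).1 _ _))//.
  by rewrite [leRHS]splitr lerD ?[`|(s N).1 - _|]distrC ?sN.
set y := limn u in sy.
have ys n : `|y - (s n).1| <= (s n).2.
  apply: (@cvg_norm_le _ _ (fun m => (s m).1 - (s n).1)).
    by apply: cvgB => //; apply: cvg_cst.
  by exists n => m /subnKC <-; exact: sdist.
have Yy : closed_span e y.
  apply: (closed_cvg _ (@closed_closure _ _) _ _ sy).
  by apply: nearW => n; have [] := sP n.
(* The limit [y] lies in all the balls, yet its own expansion is bounded by some [N], which the ball
   built at stage [N] excludes. *)
have [a ay _] := be _ Yy.
have [N By] := has_expansion_bounded ay.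
have [_ _ _ _ /(_ _ By)] := gP N.
by rewrite distrC ltNge ys.
Qed.

(** The approximate half of the open mapping theorem: [t *: y] is a difference of two points of the
    ball around [y0], and both can be approximated by vectors with expansions bounded by [N]. *)
Lemma expansion_approx e : basic_sequence e -> exists2 C : R, 0 < C &
  forall y (eta : R), closed_span e y -> 0 < eta -> `|y| <= eta ->
  exists2 z, bounded_expansion e (C * eta) z & `|y - z| <= eta / 2.
Proof.
move=> /expansion_category[N [r [y0 [r0 Yy0 By0]]]].
exists (4 * (N%:R + 1) / r) => [|y eta Yy eta0 yeta].
  by rewrite divr_gt0// mulr_gt0// ltr_wpDl.
(* This brings [t *: y] within [r / 2] of 0; two errors [r / 8] become [eta / 2] after division by
   [t], and the bound [2 * N / t] stays below [C * eta]. *)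
pose t := r / (2 * eta).
have t0 : 0 < t by rewrite divr_gt0// mulr_gt0.
have r8 : 0 < r / 8 by rewrite divr_gt0.
have [|z1 Bz1 yz1] := (closureP _ _).1 (By0 _ (closed_span_lin (c := t) Yy0 Yy) _) _ r8.
  rewrite addrAC subrr add0r normrZ gtr0_norm// /t.
  rewrite (@le_lt_trans _ _ (r / (2 * eta) * eta))//.
    by rewrite ler_wpM2l// ltW.
  by rewrite invfM mulrA mulfVK ?gt_eqF// gtr_pMr// invf_lt1 ?ltr1n.
have [|z2 Bz2 yz2] := (closureP _ _).1 (By0 _ Yy0 _) _ r8.
  by rewrite subrr normr0.
exists (t^-1 *: (z1 - z2)).
  have B12 : bounded_expansion e (N%:R + `|-1| * N%:R) (z1 + (- 1) *: z2).
    exact: bounded_expansion_lin.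
  have := bounded_expansion_lin t^-1 (bounded_expansion0 e) B12.
  rewrite !add0r scaleN1r; apply: bounded_expansion_le.
  rewrite normrN1 mul1r gtr0_norm ?invr_gt0// /t invf_div.
  rewrite [leLHS]mulrAC [leRHS]mulrAC ler_pM2r ?invr_gt0//.
  rewrite mulrAC ler_pM2r//; lra.
rewrite (_ : y - _ = t^-1 *: ((y0 + t *: y - z1) - (y0 - z2))); last first.
  rewrite -[y0 + _ - _]addrA opprD opprK addrACA subrr add0r -addrA.
  by rewrite [in RHS]scalerDr scalerK ?gt_eqF// -scalerN opprB [z2 - z1]addrC.
rewrite normrZ gtr0_norm ?invr_gt0// mulrC ler_pdivrMr//.
rewrite (le_trans (ler_normB _ _))// (@le_trans _ _ (r / 8 + r / 8))//.
  by rewrite ltW// ltrD.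
by rewrite le_eqVlt; apply/orP; left; apply/eqP; rewrite /t; field; rewrite gt_eqF.
Qed.

(** Successive approximation halves the residual at each step, and the partial sums of the
    corrections add up geometrically. This gives some expansion bounded by [2 * C] times the norm,
    and by uniqueness it is the given one. *)
Lemma basis_projections e : normalized e -> basic_sequence e ->
  exists K : R, forall a n m, (n <= m)%N -> `|psum e a n| <= K * `|psum e a m|.
Proof.
move=> ne be; have [C C0 approx] := expansion_approx be.
have [Ye Yu] := be.
have YB y : closed_span e y -> bounded_expansion e (2 * C * `|y|) y.
  move=> Yy; have [->|y0] := eqVneq y 0.
    by rewrite normr0 mulr0; exact: bounded_expansion0.
  have eta0 k : 0 < `|y| / 2 ^+ k by rewrite divr_gt0 ?normr_gt0 ?exprn_gt0.
  (* The state is the current residual with the coefficients of the part of [y] expanded so far. *)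
  have step k (p : X * (nat -> R)) : exists q : X * (nat -> R),
      closed_span e p.1 -> `|p.1| <= `|y| / 2 ^+ k -> has_expansion e p.2 (y - p.1) ->
      [/\ closed_span e q.1, `|q.1| <= `|y| / 2 ^+ k.+1, has_expansion e q.2 (y - q.1) &
       forall n, `|psum e q.2 n - psum e p.2 n| <= C * `|y| / 2 ^+ k].
    have [[Yp [pk hp]]|np] := pselect (closed_span e p.1 /\ `|p.1| <= `|y| / 2 ^+ k /\
      has_expansion e p.2 (y - p.1)); last first.
      by exists p => Yp pk hp; exfalso; apply: np.
    have [z [a az aC] pz] := approx p.1 _ Yp (eta0 k) pk.
    exists (p.1 - z, fun i => p.2 i + 1 * a i) => _ _ _; split => /=.
    - rewrite -scaleN1r; apply: closed_span_lin => //.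
      exact: has_expansion_span az.
    - by rewrite exprSr invfM mulrA.
    - rewrite opprB addrA addrAC -[z in _ + z](scale1r z).
      exact: has_expansion_lin.
    - by move=> n; rewrite psum_lin scale1r addrAC subrr add0r -mulrA.
  pose g k p := projT1 (cid (step k p)).
  pose fix s k : X * (nat -> R) := if k is m.+1 then g m (s m) else (y, fun=> 0).
  have sP k : [/\ closed_span e (s k).1, `|(s k).1| <= `|y| / 2 ^+ k &
      has_expansion e (s k).2 (y - (s k).1)].
    elim: k => [|k [IH1 IH2 IH3]] /=; last first.
      by rewrite /g; case: cid => q /= /(_ IH1 IH2 IH3)[].
    rewrite expr0 divr1 subrr; split => //.
    have -> : (0 : X) = psum e (fun=> 0) 0 by rewrite /psum big_geq.
    exact: has_expansion_stationary.
  have sS n k : `|psum e (s k.+1).2 n - psum e (s k).2 n| <= C * `|y| / 2 ^+ k.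
    by have [s1 s2 s3] := sP k; rewrite /= /g; case: cid => q /= /(_ s1 s2 s3)[].
  have sd n := geometric_dist (sS n).
  have [|||a ya sa] := @expansion_limit _ _ e (fun k => (s k).2)
    (fun k => y - (s k).1) y ne.
  - apply/cvg_seqP => eps eps0; have [N Neps] := geometric_small `|y| eps0.
    exists N => n Nn; rewrite subKr; have [_ sn _] := sP n.
    by rewrite (le_trans sn)// Neps.
  - by move=> k; have [] := sP k.
  - move=> eps eps0.
    have [N Neps] := geometric_small (2 * (C * `|y|)) (divr_gt0 eps0 (ltr0n R 2)).
    exists N => k l Nk Nl n.
    rewrite (le_trans (ler_distD (psum e (s N).2 n) _ _))//.
    rewrite [leRHS]splitr lerD//; last rewrite distrC;
      by rewrite (le_trans (sd _ _ _ _))// Neps.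
  exists a => // n; apply: (cvg_norm_le (sa n)); exists 0%N => k _.
  have := sd n 0%N k (leq0n k); rewrite /= expr0 divr1 mulrA; congr (`|_| <= _).
  by rewrite [X in _ - X]big1 ?subr0// => i _; rewrite scale0r.
exists (2 * C) => a n m nm.
(* Cut off at [m], the coefficients form an expansion of [psum e a m], to which uniqueness
   applies. *)
pose a' i := if (i < m)%N then a i else 0.
have a'E k : (k <= m)%N -> psum e a' k = psum e a k.
  move=> km; rewrite /psum !big_nat; apply: eq_bigr => i /andP[_ ik].
  by rewrite /a' (leq_trans ik km).
have xa' : has_expansion e a' (psum e a m).
  rewrite -a'E//; apply: has_expansion_stationary => i.
  by rewrite /a' ltnNge => ->.
have Yx : closed_span e (psum e a m) by apply: has_expansion_span xa'.
have [b xb bC] := YB _ Yx.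
have [c _ cu] := Yu _ Yx.
rewrite -(a'E n)// (_ : psum e a' n = psum e b n)//.
rewrite /psum !big_nat; apply: eq_bigr => i /andP[i1 _].
by rewrite (cu _ xa')// (cu _ xb).
Qed.

End BasisConstant.

(** * Convex hulls and Riemann sums over disjoint cells *)

Section Hull.
Context {R : realType} {X : normedModType R}.

(* The closed convex hull of S is contained in this intersection of balls,
   which is all that norm estimates need. *)
Definition in_hull (S : set X) (y : X) : Prop :=
  forall w c, (forall v, S v -> `|w + v| <= c) -> `|w + y| <= c.

(** The [y k] are replaced by elements of [S k] one at a time; [w] absorbs the terms already
    replaced. *)
Lemma in_hull_sum (M : nat) (S : nat -> set X) (y : nat -> X) (c : R) (w : X) :
  (forall k, (k < M)%N -> in_hull (S k) (y k)) ->
  (forall v, (forall k, (k < M)%N -> S k (v k)) -> `|w + \sum_(k < M) v k| <= c) ->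
  `|w + \sum_(k < M) y k| <= c.
Proof.
elim: M w => [|M IH] w hS bS.
  by rewrite big_ord0; move: (bS y); rewrite big_ord0; apply.
rewrite big_ord_recr /= addrA; apply: (hS M (ltnSn M)) => x Sx.
rewrite addrAC; apply: IH => [k kM|v Sv]; first by apply: hS; rewrite ltnS ltnW.
have := bS (fun k => if k == M then x else v k).
rewrite big_ord_recr /= eqxx -addrA [_ + x]addrC.
rewrite (eq_bigr (fun k : 'I_M => v k)); first apply.
  by move=> k; case: eqP => [-> //|kM]; rewrite ltnS leq_eqVlt => /predU1P[//|/Sv].
by move=> k _; rewrite ltn_eqF.
Qed.

Lemma in_hull_wsum (S : set X) (I : Type) (r : seq I) (P : pred I)
    (a : I -> R) (v : I -> X) :
  S 0 -> (forall i, P i -> 0 <= a i) -> (forall i, P i -> a i = 0 \/ S (v i)) ->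
  \sum_(i <- r | P i) a i <= 1 -> in_hull S (\sum_(i <- r | P i) a i *: v i).
Proof.
move=> S0 a0 Sv; set A := \sum_(i <- r | P i) a i => A1 w c wc.
have -> : w + \sum_(i <- r | P i) a i *: v i =
    (1 - A) *: w + \sum_(i <- r | P i) a i *: (w + v i).
  under [in RHS]eq_bigr do rewrite scalerDr.
  by rewrite big_split /= -scaler_suml addrA -scalerDl subrK scale1r.
have c0 : `|w| <= c by move: (wc 0 S0); rewrite addr0.
rewrite (le_trans (ler_normD _ _))// -[leRHS]mul1r -[X in _ <= X * _](subrK A).
rewrite mulrDl lerD//.
  by rewrite normrZ ger0_norm ?subr_ge0// ler_wpM2l ?subr_ge0.
rewrite (le_trans (ler_norm_sum _ _ _))// mulr_suml ler_sum// => i Pi.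
rewrite normrZ ger0_norm ?a0//.
by have [->|/wc] := Sv i Pi; [rewrite !mul0r|apply: ler_wpM2l; exact: a0].
Qed.

End Hull.

(** * Cauchy estimates for Riemann sums over disjoint cells *)

Section RiemannCells.
Context {R : realType} {X : normedModType R}.
Implicit Types (f : R -> X).

(* Some partition of [u, v] of mesh less than delta has two taggings whose
   Riemann sums differ by D. *)
Inductive two_taggings f (delta : R) : R -> R -> X -> Prop :=
| two_taggings_nil v : two_taggings f delta v v 0
| two_taggings_cons u x v t t' D : u < x -> x - u < delta ->
    u <= t <= x -> u <= t' <= x -> two_taggings f delta x v D ->
    two_taggings f delta u v ((x - u) *: (f t - f t') + D).

Lemma two_taggings_cat f delta u v w D D' : two_taggings f delta u v D ->
  two_taggings f delta v w D' -> two_taggings f delta u w (D + D').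
Proof.
elim=> [{}v|{}u x {}v t t' {}D ux xu ut ut' _ IH] vw; first by rewrite add0r.
by rewrite -addrA; apply: two_taggings_cons => //; apply: IH.
Qed.

(** Equal tags contribute 0, so an interval can be subdivided freely to make the mesh small. *)
Lemma two_taggings_fill f delta u v : 0 < delta -> u <= v ->
  two_taggings f delta u v 0.
Proof.
move=> d0 uv; have d2 : 0 < delta / 2 by rewrite divr_gt0.
(* The induction is on a number of steps of length [delta / 2] that suffices to reach [v]. *)
have : v - u <= (Num.truncn ((v - u) / (delta / 2))).+1%:R * (delta / 2).
  by rewrite -ler_pdivrMr// ltW// truncnS_gt.
move: (Num.truncn _).+1 => N; elim: N u uv => [|N IH] u uv uN.
  have -> : u = v by apply/eqP; rewrite eq_le uv -subr_le0 (le_trans uN)// mul0r.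
  exact: two_taggings_nil.
have [->|neq_uv] := eqVneq u v; first exact: two_taggings_nil.
have {}uv : u < v by rewrite lt_neqAle neq_uv.
pose x := Num.min v (u + delta / 2).
have ux : u < x by rewrite lt_min uv ltrDl.
have xu : x - u < delta.
  rewrite ltrBlDl gt_min; apply/orP; right.
  by rewrite ltrD2l gtr_pMr// invf_lt1 ?ltr1n.
have -> : 0 = (x - u) *: (f u - f u) + 0 :> X by rewrite subrr scaler0 addr0.
have uux : u <= u <= x by rewrite lexx ltW.
apply: two_taggings_cons => //; have [vx|xv] := leP v (u + delta / 2).
  by rewrite /x min_l//; exact: two_taggings_nil.
rewrite /x min_r ?(ltW xv)//; apply: IH; first exact: ltW.
by move: uN; rewrite -natr1 mulrDl mul1r; lra.
Qed.

(** Induction peels off the last cell: the earlier ones lie between [u] and [a M], and the gap after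
    [b M] is filled with equal tags. *)
Lemma two_taggings_cells f delta (M : nat) (a b t t' : nat -> R) u v :
  0 < delta -> u <= v ->
  (forall k, (k < M)%N -> [/\ u <= a k, a k < b k, b k <= v & b k - a k < delta]) ->
  (forall k, (k < M)%N -> a k <= t k <= b k /\ a k <= t' k <= b k) ->
  (forall k l, (k < l)%N -> (l < M)%N -> b k <= a l) ->
  two_taggings f delta u v (\sum_(k < M) (b k - a k) *: (f (t k) - f (t' k))).
Proof.
move=> d0; elim: M v => [|M IH] v uv ab tt ba.
  by rewrite big_ord0; exact: two_taggings_fill.
have [uM abM bv dM] := ab M (ltnSn _); have [tM t'M] := tt M (ltnSn _).
rewrite big_ord_recr /=.
apply: (@two_taggings_cat _ _ _ (a M)).
  apply: IH => //.
  - move=> k kM; have [|uk abk _ dk] := ab k; first exact: ltnW.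
    by split => //; apply: ba.
  - by move=> k kM; apply: tt; exact: ltnW.
  - by move=> k l kl lM; apply: ba => //; exact: ltnW.
rewrite -[(b M - a M) *: _]addr0.
by apply: two_taggings_cons => //; exact: two_taggings_fill.
Qed.

Lemma two_taggings_seq f delta u v D : two_taggings f delta u v D ->
  exists s t t' : seq R, [/\ itv_partition u v s,
   size t = size s /\ size t' = size s,
   forall i, (i < size s)%N -> [/\ (u :: s)`_i.+1 - (u :: s)`_i < delta,
     (u :: s)`_i <= t`_i <= (u :: s)`_i.+1 &
     (u :: s)`_i <= t'`_i <= (u :: s)`_i.+1] &
   D = \sum_(i < size s) ((u :: s)`_i.+1 - (u :: s)`_i) *: f t`_i -
       \sum_(i < size s) ((u :: s)`_i.+1 - (u :: s)`_i) *: f t'`_i].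
Proof.
elim=> [{}v|{}u x {}v y y' {}D ux xu uy uy' _ [s [t [t' [sp [st st'] stP ->]]]]].
  by exists [::], [::], [::]; split => //; rewrite !big_ord0 subrr.
exists (x :: s), (y :: t), (y' :: t'); split.
- by case: sp => sp sv; split => //=; rewrite ux sp.
- by rewrite /= st st'.
- by case=> [|i] //=; rewrite ltnS => /stP.
- by rewrite /= !big_ord_recl /= opprD addrACA -scalerBr.
Qed.

Lemma mesh_lt (s : seq R) (delta : R) : 0 < delta ->
  (forall i, (i < size s)%N -> cell_length s i < delta) -> mesh s < delta.
Proof.
move=> d0 sd; rewrite /mesh; elim/big_ind : _ => // [x y|i _]; last exact: sd.
by move=> xd yd; rewrite gt_max xd.
Qed.

(** Completing the cells to a fine partition with equal tags elsewhere gives two Riemann sums, each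
    within [eps / 2] of the integral. *)
Lemma riemann_cells f : riemann_integrable f -> forall eps : R, 0 < eps ->
  exists2 delta : R, 0 < delta & forall (M : nat) (a b t t' : nat -> R),
  (forall k, (k < M)%N -> [/\ 0 <= a k, a k < b k, b k <= 1 & b k - a k < delta]) ->
  (forall k, (k < M)%N -> a k <= t k <= b k /\ a k <= t' k <= b k) ->
  (forall k l, (k < l)%N -> (l < M)%N -> b k <= a l) ->
  `|\sum_(k < M) (b k - a k) *: (f (t k) - f (t' k))| <= eps.
Proof.
move=> [x fx] eps eps0.
have [delta d0 fd] := fx _ (divr_gt0 eps0 (ltr0n _ 2)).
exists delta => // M a b t t' ab tt ba.
have /two_taggings_seq[s [r [r' [sp [rs r's] stP ->]]]] :=
  two_taggings_cells f d0 ler01 ab tt ba.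
have ms : mesh s < delta by apply: mesh_lt => // i /stP[].
rewrite [leRHS]splitr (le_trans (ler_distD x _ _))// lerD//.
  by rewrite distrC ltW// fd//; split => // i /stP[].
by rewrite ltW// fd//; split => // i /stP[].
Qed.

Definition unit_vector (x : X) : X := `|x|^-1 *: x.

Lemma norm_unit_vector (x : X) : 0 < `|x| -> `|unit_vector x| = 1.
Proof. by move=> x0; rewrite normrZ gtr0_norm ?invr_gt0// mulVf// gt_eqF. Qed.

(** A unit vector is [d^-1] times the difference, multiplied by a factor between 0 and 1. By
    convexity it suffices to bound sums in which each scaled difference is kept or replaced by 0. *)
Lemma riemann_unit_cells f (d : R) : riemann_integrable f -> 0 < d ->
  forall eps : R, 0 < eps ->
  exists2 delta : R, 0 < delta &
  forall (M : nat) (P : pred nat) (a b t t' : nat -> R),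
  (forall k, (k < M)%N -> [/\ 0 <= a k, a k < b k, b k <= 1 & b k - a k < delta]) ->
  (forall k l, (k < l)%N -> (l < M)%N -> b k <= a l) ->
  (forall k, (k < M)%N -> P k -> [/\ a k <= t k <= b k, a k <= t' k <= b k &
     d <= `|f (t k) - f (t' k)|]) ->
  `|\sum_(k < M | P k) (b k - a k) *: unit_vector (f (t k) - f (t' k))| <= eps.
Proof.
move=> fint d0 eps eps0.
have [delta delta0 fd] := riemann_cells fint (mulr_gt0 eps0 d0).
exists delta => // M P a b t t' ab ba tt.
pose x k := (b k - a k) *: (f (t k) - f (t' k)).
pose S k : set X := [set y | y = 0 \/ P k /\ y = d^-1 *: x k].
pose y k := if P k then (b k - a k) *: unit_vector (f (t k) - f (t' k)) else 0.
rewrite big_mkcond/= -[X in `|X|]add0r.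
apply: (@in_hull_sum _ _ M S y eps 0) => [k kM|v Sv].
  rewrite /y; case: ifPn => Pk; last first.
    by move=> w c Sc; apply: Sc; left.
  have [_ _ dk] := tt k kM Pk.
  pose c := d / `|f (t k) - f (t' k)|.
  have -> : (b k - a k) *: unit_vector (f (t k) - f (t' k)) =
      \sum_(i <- [:: tt]) c *: (d^-1 *: x k).
    rewrite big_seq1 /x /unit_vector !scalerA; congr (_ *: _).
    by rewrite /c; field; rewrite !gt_eqF ?(lt_le_trans d0).
  apply: in_hull_wsum => [|_ _|_ _|]; first by left.
  - by rewrite divr_ge0// ltW.
  - by right; right.
  - by rewrite big_seq1 ler_pdivrMr ?mul1r// (lt_le_trans d0).
rewrite add0r.
(* A term 0 is realized by placing both tags at [a k]. *)
pose T k := if pselect (v k = 0) then a k else t k.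
pose T' k := if pselect (v k = 0) then a k else t' k.
have -> : \sum_(k < M) v k = d^-1 *: \sum_(k < M) (b k - a k) *: (f (T k) - f (T' k)).
  rewrite scaler_sumr; apply: eq_bigr => k _.
  rewrite /T /T'; case: pselect => [v0|nv] /=.
    by rewrite v0 subrr !scaler0.
  by case: (Sv k (ltn_ord k)) => [//|[_ ->]].
rewrite normrZ gtr0_norm ?invr_gt0// mulrC ler_pdivrMr//.
apply: fd => // k kM; rewrite /T /T'; case: pselect => nv /=.
  by have [_ /ltW akb _ _] := ab k kM; rewrite lexx akb.
by case: (Sv k kM) => [//|[Pk _]]; have [] := tt k kM Pk.
Qed.

(** The model for [phi x] is the measure of the set of points up to [x] at which [f] oscillates by
    at least [d]. *)
Definition oscillation_mass f (d : R) (phi : R -> R) : Prop :=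
  [/\ {homo phi : x y / x <= y}, forall x y, x <= y -> phi y - phi x <= y - x,
    phi 0 = 0, 0 < phi 1 &
    forall x y, 0 <= x -> x < y -> y <= 1 -> phi x < phi y ->
      exists t t', [/\ x <= t <= y, x <= t' <= y & d <= `|f t - f t'|]].

End RiemannCells.

(** * Selection of almost independent increments *)

Section Selection.
Context {R : realType} {X : completeNormedModType R}.
Implicit Types (e : nat -> X) (f : R -> X).

Lemma itv_net (B eta : R) : 0 < eta ->
  exists L : seq R, forall s, `|s| <= B -> exists2 s', s' \in L & `|s - s'| <= eta.
Proof.
move=> eta0; pose N := (Num.truncn (2 * B / eta)).+1.
exists [seq - B + k%:R * eta | k <- iota 0 N] => s; rewrite ler_norml => /andP[Bs sB].
pose k := Num.truncn ((s + B) / eta).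
have sB0 : 0 <= (s + B) / eta by rewrite divr_ge0 ?(ltW eta0)//; lra.
exists (- B + k%:R * eta).
  apply/mapP; exists k => //; rewrite mem_iota leq0n add0n ltnS /k.
  by apply: le_truncn; rewrite ler_pM2r ?invr_gt0//; lra.
have /andP[k1 k2] := truncn_itv sB0.
have {}k1 : k%:R * eta <= s + B by rewrite -ler_pdivlMr.
have {}k2 : s + B < k%:R * eta + eta.
  by move: k2; rewrite ltr_pdivrMr// -natr1 mulrDl mul1r.
rewrite ler_norml; lra.
Qed.

Lemma psum_net e (n : nat) (B eta : R) : (forall i, (1 <= i < n)%N -> `|e i| = 1) ->
  0 < eta -> exists L : seq X, forall a, (forall i, (1 <= i < n)%N -> `|a i| <= B) ->
    exists2 y, y \in L & `|psum e a n - y| <= eta.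
Proof.
move=> + eta0; case: n => [|n].
  exists [:: 0] => a _; exists 0; rewrite ?mem_head//.
  by rewrite /psum big_geq// subrr normr0 ltW.
elim: n eta eta0 => [|n IH] eta eta0 ne.
  exists [:: 0] => a _; exists 0; rewrite ?mem_head//.
  by rewrite /psum big_geq// subrr normr0 ltW.
have eta2 : 0 < eta / 2 by rewrite divr_gt0.
have [|L LP] := IH _ eta2.
  by move=> i /andP[i1 iN]; apply: ne; rewrite i1 ltnW.
have [L' L'P] := itv_net B eta2.
exists [seq y + s *: e n.+1 | y <- L, s <- L'] => a aB.
have [|y yL ay] := LP a.
  by move=> i /andP[i1 iN]; apply: aB; rewrite i1 ltnW.
have [s sL as_] := L'P (a n.+1) (aB n.+1 (leqnn _)).
exists (y + s *: e n.+1); first by apply/allpairsP; exists (y, s).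
rewrite psumS// opprD addrACA -scalerBl [leRHS]splitr.
by rewrite (le_trans (ler_normD _ _))// lerD// normrZ ne ?mulr1/=.
Qed.

(* Otherwise, by pigeonhole over a finite net, many disjoint small cells share
   one pair (y, s) with |y + s x| < |y| for the normalized differences x chosen
   in these cells; averaging and letting the mesh tend to 0, where the averages
   of the x tend to 0, contradicts the triangle inequality. *)
Lemma select_increment f (d : R) (phi : R -> R) e (n : nat) (K u v eps rho : R) :
  riemann_integrable f -> 0 < d -> oscillation_mass f d phi ->
  (forall i, (1 <= i < n)%N -> `|e i| = 1) ->
  (forall a k, (k <= n)%N -> `|psum e a k| <= K * `|psum e a n|) ->
  0 <= u -> u < v -> v <= 1 -> phi u < phi v -> 0 < eps -> 0 < rho ->
  exists t t', [/\ u <= t <= v, u <= t' <= v, `|t - t'| <= rho,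
    d <= `|f t - f t'| & forall a (s : R),
    (1 - eps) * `|psum e a n| <= `|psum e a n + s *: unit_vector (f t - f t')|].
Proof.
move=> fint d0 [phi_homo phi_lip _ _ phi_osc] ne eK u0 uv v1 phiuv eps0 rho0.
apply: contrapT => nsel.
have eps4 : 0 < eps / 4 by rewrite divr_gt0.
(* Once the partial sum is scaled to norm 1, each coefficient is a difference of two projections,
   hence the bound [2 * K]; a multiple [s] that decreases the norm is at most 2 in absolute
   value. *)
have [L1 L1P] := @psum_net e n (2 * `|K|) _ ne eps4.
have [L2 L2P] := itv_net 2 eps4.
pose L := [seq (y, s) | y <- L1, s <- L2].
have L0 : (0 < size L)%N.
  have [|y yL _] := L1P (fun=> 0); first by move=> *; rewrite normr0 mulr_ge0.
  have [|s sL _] := L2P 0; first by rewrite normr0.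
  have : (y, s) \in L by apply/allpairsP; exists (y, s).
  by case: L.
(* Rounding to the net costs three errors of [eps / 4], which leaves [eps / 4] of the decrease
   [eps]. *)
have label t t' : u <= t <= v -> u <= t' <= v -> `|t - t'| <= rho ->
    d <= `|f t - f t'| -> exists i : 'I_(size L), let p := nth (0, 0) L i in
    `|p.1 + p.2 *: unit_vector (f t - f t')| <= `|p.1| - eps / 4.
  move=> ut ut' tt' dtt'.
  have [a [s]] : exists a s, `|psum e a n + s *: unit_vector (f t - f t')| <
      (1 - eps) * `|psum e a n|.
    apply: contrapT => nas; apply: nsel; exists t, t'; split => // a s.
    by rewrite leNgt; apply/negP => ?; apply: nas; exists a, s.
  set x := unit_vector _.
  have nx : `|x| = 1 by apply: norm_unit_vector; exact: lt_le_trans dtt'.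
  set y := psum e a n => yx.
  have y0 : 0 < `|y|.
    rewrite normr_gt0; apply: contraTneq yx => ->.
    by rewrite normr0 mulr0 normr_lt0.
  pose a1 i := `|y|^-1 * a i.
  have ya1 k : psum e a1 k = `|y|^-1 *: psum e a k by exact: psumZ.
  have ny1 : `|psum e a1 n| = 1.
    by rewrite ya1 normrZ gtr0_norm ?invr_gt0// mulVf// gt_eqF.
  pose s1 := `|y|^-1 * s.
  have yx1 : `|psum e a1 n + s1 *: x| < 1 - eps.
    rewrite ya1 -scalerA -scalerDr normrZ gtr0_norm ?invr_gt0//.
    by rewrite mulrC ltr_pdivrMr.
  have [|y' yL yy'] := L1P a1.
    move=> i /andP[i1 iN].
    have -> : `|a1 i| = `|psum e a1 i.+1 - psum e a1 i|.
      by rewrite psumS// addrC addKr [RHS]normrZ ne ?i1 ?iN// mulr1.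
    rewrite (le_trans (ler_normB _ _))// mulrDl mul1r lerD//.
      by rewrite (le_trans _ (ler_norm K))// -[K]mulr1 -ny1; apply: eK.
    by rewrite (le_trans _ (ler_norm K))// -[K]mulr1 -ny1; apply: eK; exact: ltnW.
  have [|s' sL ss'] := L2P s1.
    rewrite -[`|s1|]mulr1 -nx -normrZ -(addKr (psum e a1 n) (s1 *: x)) addrC.
    rewrite (le_trans (ler_normB _ _))// ny1; lra.
  have pL : (y', s') \in L by apply/allpairsP; exists (y', s').
  have iL : (index (y', s') L < size L)%N by rewrite index_mem.
  exists (Ordinal iL) => /=; rewrite nth_index//=.
  have y'1 : 1 <= `|y'| + eps / 4.
    by have := ler_normD (psum e a1 n - y') y'; rewrite subrK ny1; lra.
  have : `|y' + s' *: x| <= `|psum e a1 n + s1 *: x| + (eps / 4 + eps / 4).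
    have := ler_normD (y' + s' *: x - (psum e a1 n + s1 *: x)) (psum e a1 n + s1 *: x).
    rewrite subrK => /le_trans; apply; rewrite [leRHS]addrC lerD2r.
    rewrite opprD addrACA -scalerBl (le_trans (ler_normD _ _))//.
    apply: lerD; first by rewrite distrC.
    by rewrite normrZ nx mulr1 distrC.
  lra.
(* The added 1 keeps [Bs] positive and makes the final comparison strict. *)
pose Bs := \sum_(i < size L) `|(nth (0, 0) L i).2| + 1.
have Bs0 : 0 < Bs by rewrite ltr_wpDl// sumr_ge0.
pose eta := (phi v - phi u) * (eps / 4) / Bs.
have eta0 : 0 < eta by rewrite divr_gt0// mulr_gt0// subr_gt0.
have [delta delta0 fd] := riemann_unit_cells fint d0 eta0.
pose m := Num.min delta rho.
have m0 : 0 < m by rewrite lt_min delta0.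
pose N := (Num.truncn ((v - u) / m)).+1.
have N0 : 0 < N%:R :> R by rewrite ltr0n.
pose h := (v - u) / N%:R.
have h0 : 0 < h by rewrite divr_gt0// subr_gt0.
have hm : h < m by rewrite ltr_pdivrMr// mulrC -ltr_pdivrMr// truncnS_gt.
pose a (k : nat) := u + k%:R * h.
have aS k : a k.+1 - a k = h by rewrite /a -natr1; ring.
have ale k l : (k <= l)%N -> a k <= a l.
  by move=> kl; rewrite lerD2l ler_pM2r// ler_nat.
have aN : a N = v by rewrite /a /h mulrCA divff ?gt_eqF// mulr1 addrC subrK.
have a0 : a 0%N = u by rewrite /a mul0r addr0.
(* An increase of [phi] on a cell provides two points there with values at least [d] apart. *)
pose P k := phi (a k) < phi (a k.+1).
have cell k : exists q : R * R * 'I_(size L), (k < N)%N -> P k ->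
    [/\ a k <= q.1.1 <= a k.+1, a k <= q.1.2 <= a k.+1,
    d <= `|f q.1.1 - f q.1.2| & let p := nth (0, 0) L q.2 in
    `|p.1 + p.2 *: unit_vector (f q.1.1 - f q.1.2)| <= `|p.1| - eps / 4].
  have [[kN Pk]|nP] := pselect ((k < N)%N /\ P k); last first.
    by exists (0, 0, Ordinal L0) => kN Pk; exfalso; apply: nP.
  have [|||t [t' [kt kt' dt]]] := phi_osc (a k) (a k.+1) _ _ _ Pk.
  - by rewrite (le_trans u0)// -a0 ale.
  - by rewrite -subr_gt0 aS.
  - by rewrite (le_trans _ v1)// -aN ale.
  have sub x : a k <= x <= a k.+1 -> u <= x <= v.
    move=> /andP[kx xk]; rewrite -[X in X <= _]a0 -aN (le_trans (ale _ _ (leq0n k)))//.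
    by rewrite (le_trans xk)// ale.
  have [|||//|i iP] := label t t'.
  - exact: sub.
  - exact: sub.
  - have : h <= rho by rewrite ltW// (lt_le_trans hm)// ge_min lexx orbT.
    by have := aS k; rewrite ler_norml; lra.
  by exists (t, t', i).
have {cell}[q qP] := choice cell.
(* Since [phi] is 1-Lipschitz, the cells where it increases have at least this total length. *)
have sumP : phi v - phi u <= \sum_(k < N | P k) h.
  rewrite -aN -a0 -(telescope_sumr (fun k => phi (a k)))// big_mkord.
  rewrite [leRHS]big_mkcond/=; apply: ler_sum => k _; case: ifPn => [_|].
    by rewrite -(aS k) phi_lip// ale.
  by rewrite -leNgt subr_le0.
(* Over the cells with one label, the unit vectors nearly cancel, so the triangle inequality bounds
   the loss of [eps / 4] per unit of length by a multiple of [eta]. *)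
have main i : (\sum_(k < N | P k && ((q k).2 == i)) h) * (eps / 4) <=
    `|(nth (0, 0) L i).2| * eta.
  set p := nth _ _ _; set H := \sum_(k < N | _) h.
  pose x (k : nat) := unit_vector (f (q k).1.1 - f (q k).1.2).
  have sx : `|\sum_(k < N | P k && ((q k).2 == i)) h *: x k| <= eta.
    have := fd N (fun k => P k && ((q k).2 == i)) a (fun k => a k.+1)
      (fun k => (q k).1.1) (fun k => (q k).1.2).
    under eq_bigr do rewrite aS.
    apply.
    - move=> k kN; split.
      + by rewrite (le_trans u0)// -a0 ale.
      + by rewrite -subr_gt0 aS.
      + by rewrite (le_trans _ v1)// -aN ale.
      + by rewrite aS (lt_le_trans hm)// ge_min lexx.
    - by move=> k l kl lN; exact: ale.
    - by move=> k kN /andP[Pk _]; have [] := qP k kN Pk.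
  have H0 : 0 <= H by rewrite sumr_ge0// => k _; exact: ltW.
  have le1 : `|\sum_(k < N | P k && ((q k).2 == i)) h *: (p.1 + p.2 *: x k)| <=
      H * (`|p.1| - eps / 4).
    rewrite (le_trans (ler_norm_sum _ _ _))// mulr_suml ler_sum// => k /andP[Pk /eqP ki].
    rewrite normrZ gtr0_norm// ler_pM2l//.
    by have [_ _ _ +] := qP k (ltn_ord k) Pk; rewrite ki.
  have : H * `|p.1| - `|p.2| * eta <=
      `|\sum_(k < N | P k && ((q k).2 == i)) h *: (p.1 + p.2 *: x k)|.
    set Z := \sum_(k < N | P k && ((q k).2 == i)) h *: x k in sx *.
    have -> : \sum_(k < N | P k && ((q k).2 == i)) h *: (p.1 + p.2 *: x k) =
        H *: p.1 + p.2 *: Z.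
      rewrite scaler_suml scaler_sumr -big_split/=; apply: eq_bigr => k _.
      by rewrite scalerDr !scalerA [h * _]mulrC.
    have := ler_normB (H *: p.1 + p.2 *: Z) (p.2 *: Z).
    rewrite addrK [`|H *: _|]normrZ [`|p.2 *: _|]normrZ (ger0_norm H0).
    by have := ler_wpM2l (normr_ge0 p.2) sx; lra.
  by move/le_trans => /(_ _ le1); rewrite mulrBr; lra.
(* Summing over the labels contradicts the choice of [eta], as [Bs * eta] is the left side. *)
have : (phi v - phi u) * (eps / 4) <= (Bs - 1) * eta.
  rewrite (@le_trans _ _ ((\sum_(k < N | P k) h) * (eps / 4)))//.
    by rewrite ler_pM2r.
  rewrite (partition_big (fun k : 'I_N => (q k).2) xpredT)//= /Bs addrK !mulr_suml.
  by apply: ler_sum => i _; exact: main.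
rewrite leNgt => /negP; apply; rewrite mulrBl mul1r.
rewrite [X in X - _](_ : _ = (phi v - phi u) * (eps / 4)) ?gtrBl//.
by rewrite /eta mulrC divfK// gt_eqF.
Qed.
End Selection.

(** * A basic sequence with small dyadic averages *)

(** Course-of-values dependent choice; the first hypothesis says that [P n u] depends only on the
    terms of [u] before [n]. *)
Lemma strong_recursion (T : Type) (x0 : T) (P : nat -> (nat -> T) -> T -> Prop) :
  (forall n u v x, (forall i, (i < n)%N -> u i = v i) -> P n u x -> P n v x) ->
  (forall n u, (forall i, (i < n)%N -> P i u (u i)) -> exists x, P n u x) ->
  exists u, forall n, P n u (u n).
Proof.
move=> Ploc Pex.
have /choice[g gP] (nu : nat * (nat -> T)) : exists x,
    (forall i, (i < nu.1)%N -> P i nu.2 (nu.2 i)) -> P nu.1 nu.2 x.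
  have [/Pex[x Px]|nP] := pselect (forall i, (i < nu.1)%N -> P i nu.2 (nu.2 i)).
    by exists x.
  by exists x0.
(* [U n] is the table of the first [n] values, with default [x0] beyond them. *)
pose fix U n : nat -> T :=
  if n is m.+1 then (fun i => if i == m then g (m, U m) else U m i) else fun=> x0.
have UE n m i : (i < n)%N -> (n <= m)%N -> U m i = U n i.
  move=> ni; elim: m => [|m IH]; first by rewrite leqn0 => /eqP ->.
  rewrite leq_eqVlt => /predU1P[<-//|nm] /=.
  by rewrite ltn_eqF ?IH// (leq_trans ni).
pose u i := U i.+1 i.
have uU n i : (i < n)%N -> U n i = u i by move=> ni; rewrite /u (UE i.+1 n).
exists u => n; elim/ltn_ind: n => n IH.
apply: (Ploc n (U n)) => [i ni|]; first exact: uU.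
rewrite /u /= eqxx; apply: (gP (n, U n)) => i /= ni.
by rewrite uU//; apply: (Ploc i u) => [k ki|]; [rewrite uU// (ltn_trans ki)|exact: IH].
Qed.

(** * Dyadic intervals as indices, and their Haar system *)

Section DyadicIndex.

(* The index i = 2^k + r, r < 2^k, stands for the dyadic interval
   [r/2^k, (r+1)/2^k[. *)
Definition dyadic_level (i : nat) := trunc_log 2 i.
Definition dyadic_offset (i : nat) := (i - 2 ^ dyadic_level i)%N.
(** The quotient numbers the level-[m] dyadic interval containing the left endpoint of the interval
    of [i]; indices of level below [m] are thereby placed too, so all positive integers are
    covered. *)
Definition dyadic_haar (m j : nat) : set nat :=
  [set i | (1 <= i)%N /\ ((dyadic_offset i * 2 ^ m) %/ 2 ^ dyadic_level i)%N = j].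

Lemma dyadic_offset_lt i : (1 <= i)%N -> (dyadic_offset i < 2 ^ dyadic_level i)%N.
Proof.
move=> i1; have /= := @trunc_log_bounds 2 i isT i1.
rewrite /dyadic_offset /dyadic_level expnS; lia.
Qed.

Lemma dyadic_index k r : (r < 2 ^ k)%N ->
  dyadic_level (2 ^ k + r) = k /\ dyadic_offset (2 ^ k + r) = r.
Proof.
move=> rk; have kE : dyadic_level (2 ^ k + r) = k.
  by apply: trunc_log_eq => //; rewrite leq_addr /= expnS; lia.
by split => //; rewrite /dyadic_offset kE addKn.
Qed.

Lemma infinite_natP (A : set nat) :
  infinite_set A <-> forall N, exists2 i, A i & (N <= i)%N.
Proof.
split=> [Ainf N|unb].
  have [i [Ai /negP iN]] := infinite_setN0 (infinite_setD Ainf (finite_II N)).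
  by exists i => //; rewrite leqNgt.
move=> /finite_fsetP[F AF].
have [i] := unb (\max_(i <- finmap.enum_fset F) i).+1.
rewrite AF => /= iF; rewrite ltnNge => /negP; apply.
exact: leq_bigmax_seq.
Qed.

Lemma haar_system_dyadic : haar_system dyadic_haar.
Proof.
move=> m _; split.
- move=> j jm; apply/infinite_natP => N.
  have jN : (j * 2 ^ N < 2 ^ (m + N))%N by rewrite expnD ltn_pmul2r ?expn_gt0.
  have [lE oE] := dyadic_index jN.
  (* Its interval has left endpoint [j / 2 ^ m], at a level that makes the index exceed [N]. *)
  exists (2 ^ (m + N) + j * 2 ^ N)%N.
    split; first by rewrite addn_gt0 expn_gt0.
    by rewrite lE oE -mulnA -expnD [(N + m)%N]addnC mulnK ?expn_gt0.
  rewrite (leq_trans (ltnW (ltn_expl N (ltnSn 1))))//.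
  by rewrite (leq_trans _ (leq_addr _ _))// leq_exp2l// leq_addl.
- rewrite eqEsubset; split=> [i [j /= _ []//]|i /= i1].
  exists ((dyadic_offset i * 2 ^ m) %/ 2 ^ dyadic_level i)%N => //=.
  by rewrite ltn_divLR ?expn_gt0// mulnC ltn_pmul2l ?expn_gt0// dyadic_offset_lt.
- move=> j k _ _ jk; rewrite -subset0 => i /= [[_ ij] [_ ik]].
  by apply: jk; rewrite -ij.
- move=> j _; have half i : ((dyadic_offset i * 2 ^ m) %/ 2 ^ dyadic_level i =
      (dyadic_offset i * 2 ^ m.+1) %/ 2 ^ dyadic_level i %/ 2)%N.
    by rewrite -divnMA expnSr mulnA divnMr.
  rewrite eqEsubset /dyadic_haar; split => i /=; rewrite half.
    set x := (_ %/ 2 ^ _)%N => -[i1 xj].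
    have : x = (2 * j)%N \/ x = (2 * j).+1 by lia.
    by case=> ->; [left|right].
  by set x := (_ %/ 2 ^ _)%N => -[[i1 ->]|[i1 ->]]; split => //; lia.
Qed.

(** The level of [i] is at least [m], so its interval is contained in the [j]-th one of level [m];
    the bounds say so over the denominator [2 ^ (m + h)]. *)
Lemma dyadic_haar_bounds m j i : (2 ^ m <= i)%N -> dyadic_haar m j i ->
  exists h, [/\ dyadic_level i = (m + h)%N, (j * 2 ^ h <= dyadic_offset i)%N &
    ((dyadic_offset i).+1 <= j.+1 * 2 ^ h)%N].
Proof.
move=> mi [i1 <-].
have mk : (m <= dyadic_level i)%N by exact: trunc_log_max.
have -> : ((dyadic_offset i * 2 ^ m) %/ 2 ^ dyadic_level i =
    dyadic_offset i %/ 2 ^ (dyadic_level i - m))%N.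
  by rewrite -{1}(subnK mk) expnD divnMr ?expn_gt0.
exists (dyadic_level i - m)%N; split.
- by rewrite subnKC.
- exact: leq_divM.
- by rewrite -ltn_divLR ?expn_gt0.
Qed.
End DyadicIndex.


Section HaarLimit.
Context {R : realType} {X : normedModType R}.
Implicit Types (e : nat -> X) (A : nat -> nat -> set nat).

Lemma haar_averages_ge0 e A n r : haar_averages e A n r -> 0 <= r.
Proof. by move=> [m [i [_ _ ->]]]; rewrite mulr_ge0// invr_ge0 exprn_ge0. Qed.

Lemma haar_averages_lim0 e A :
  (forall eps : R, 0 < eps -> exists n, forall r, haar_averages e A n r -> r <= eps) ->
  limn (fun n => sup (haar_averages e A n)) = 0.
Proof.
move=> small; apply: cvg_lim => //; apply/cvgrPdist_le => eps eps0; have [n nr] := small _ eps0.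
exists n => // k /= nk.
have kr r : haar_averages e A k r -> r <= eps.
  by move=> [m [i [km iA rE]]]; apply: nr; exists m, i; split => //; exact: leq_trans km.
rewrite sub0r normrN; have [[r kr']|] := pselect (haar_averages e A k !=set0).
  rewrite ger0_norm.
    by apply: ge_sup; [exists r|move=> x; exact: kr].
  rewrite (le_trans (haar_averages_ge0 kr'))//.
  by apply: ub_le_sup => //; exists eps => x; exact: kr.
move=> /set0P/negP; rewrite negbK => /eqP ->.
by rewrite sup0 normr0 ltW.
Qed.
End HaarLimit.

(** * Recursive construction of the basic sequence *)

Section HaarSequence.
Context {R : realType} {X : completeNormedModType R}.
Implicit Types (e : nat -> X) (f : R -> X).

Lemma psum_eq e e' (a : nat -> R) n : (forall i, (i < n)%N -> e i = e' i) ->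
  psum e a n = psum e' a n.
Proof. by move=> ee'; apply: eq_big_nat => i /andP[_ /ee' ->]. Qed.

(** Weights increasing from 1 towards 2: if the norms of the partial sums, so weighted, never
    decrease, the projections are bounded by 2. *)
Definition slack (n : nat) : R := 2 - (2 ^+ n)^-1.

Lemma slack_ge1 n : 1 <= slack n.
Proof.
have : (2 ^+ n)^-1 <= 1 :> R by rewrite invf_le1 ?exprn_gt0// exprn_ege1 ?ler1n.
rewrite /slack; lra.
Qed.

Lemma slack_le2 n : slack n <= 2.
Proof.
have : 0 <= (2 ^+ n)^-1 :> R by rewrite invr_ge0 exprn_ge0.
rewrite /slack; lra.
Qed.

Lemma slack_lt n : slack n < slack n.+1.
Proof.
by rewrite /slack ltrD2l ltrN2 ltf_pV2 ?posrE ?exprn_gt0// ltr_eXn2l ?ltr1n.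
Qed.

Lemma slack_projections e (N : nat) :
  (forall m a, (1 <= m < N)%N ->
    slack m * `|psum e a m| <= slack m.+1 * `|psum e a m.+1|) ->
  forall a k m, (k <= m)%N -> (m <= N)%N -> `|psum e a k| <= 2 * `|psum e a m|.
Proof.
move=> mono a k m km mN.
have : slack k * `|psum e a k| <= slack m * `|psum e a m|.
  rewrite -(subnKC km) in mN *; elim: (m - k)%N mN => [|h IH] mN; first by rewrite addn0.
  rewrite (le_trans (IH _))//; first by rewrite (leq_trans _ mN)// leq_add2l.
  rewrite addnS; have [kh0|kh0] := posnP (k + h)%N; last by rewrite mono// kh0 -addnS.
  by rewrite kh0 /psum !big_geq// !normr0 !mulr0.
have := ler_wpM2r (normr_ge0 (psum e a k)) (slack_ge1 k).
have := ler_wpM2r (normr_ge0 (psum e a m)) (slack_le2 m).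
by rewrite mul1r; lra.
Qed.

(** Quantiles come from the intermediate value theorem; they are chosen arbitrarily, yet are
    monotone because [phi] is. *)
Lemma oscillation_quantile f (d : R) (phi : R -> R) : oscillation_mass f d phi ->
  exists q : R -> R, [/\ forall x, 0 <= x <= 1 -> 0 <= q x <= 1,
    forall x, 0 <= x <= 1 -> phi (q x) = phi 1 * x &
    forall x y, 0 <= x -> x <= y -> y <= 1 -> q x <= q y].
Proof.
move=> [phi_homo phi_lip phi0 phi1 _].
have phi_cont : continuous phi.
  move=> x; apply/cvgrPdist_le => eps eps0; apply/nbhs_ballP; exists eps => // y /ltW xy.
  have [yx|xy'] := leP y x.
    have := phi_lip _ _ yx; have := phi_homo _ _ yx => h1 h2.
    by move: xy; rewrite !ger0_norm ?subr_ge0//; lra.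
  have := phi_lip _ _ (ltW xy'); have := phi_homo _ _ (ltW xy') => h1 h2.
  by move: xy; rewrite !ler0_norm ?subr_le0 ?(ltW xy')//; lra.
have /choice[q qP] x : exists y, 0 <= x <= 1 -> 0 <= y <= 1 /\ phi y = phi 1 * x.
  have [x01|] := boolP (0 <= x <= 1); last by exists 0.
  have [||y y01 yE] := @IVT _ phi 0 1 (phi 1 * x) ler01.
  - exact: continuous_subspaceT.
  - rewrite phi0 min_l ?(ltW phi1)// max_r ?(ltW phi1)//.
    by case/andP: x01 => x0 x1; rewrite mulr_ge0 ?(ltW phi1)//= ger_pMr.
  by exists y => _; split => //; move: y01; rewrite in_itv.
exists q; split.
- by move=> x /qP[].
- by move=> x /qP[].
- move=> x y x0 xy y1; rewrite leNgt; apply/negP => qyx.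
  have xI : 0 <= x <= 1 by rewrite x0 (le_trans xy).
  have yI : 0 <= y <= 1 by rewrite (le_trans x0).
  have := phi_homo _ _ (ltW qyx); rewrite (qP x xI).2 (qP y yI).2 ler_pM2l// => yx.
  by move: qyx; rewrite (@le_anti _ _ x y) ?ltxx// xy.
Qed.

(** Index [i] of level [k] gets a quantile interval of mass [c / 2 ^ k], from which [e i] is
    selected. Choosing one index per interval of level [m] gives a sum of unit differences over
    disjoint cells of equal length [c / 2 ^ m]. *)
Lemma haar_null_sequence f (d : R) (phi : R -> R) : riemann_integrable f -> 0 < d ->
  oscillation_mass f d phi -> exists e, [/\ normalized e, basic_sequence e &
  forall eps : R, 0 < eps -> exists n, forall r,
    haar_averages e dyadic_haar n r -> r <= eps].
Proof.
move=> fint d0 mass; have [phi_homo phi_lip phi0 phi1 _] := mass.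
have [q [q01 phiq qle]] := oscillation_quantile mass.
pose c := phi 1.
pose E (p : R * R) := unit_vector (f p.1 - f p.2).
pose lo i := q ((dyadic_offset i)%:R / 2 ^+ dyadic_level i).
pose hi i := q ((dyadic_offset i).+1%:R / 2 ^+ dyadic_level i).
have frac01 k r : (r <= 2 ^ k)%N -> 0 <= (r%:R / 2 ^+ k : R) <= 1.
  move=> rk; rewrite divr_ge0 ?exprn_ge0//= ler_pdivrMr ?exprn_gt0// mul1r.
  by rewrite -natrX ler_nat.
have frac_le k r s : (r <= s)%N -> r%:R / 2 ^+ k <= s%:R / 2 ^+ k :> R.
  by move=> rs; rewrite ler_pM2r ?invr_gt0 ?exprn_gt0// ler_nat.
(* The distance bound [c / i] will let both points fit in one cell of length [c / 2 ^ m] when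
   [2 ^ m <= i]. *)
pose P i (u : nat -> R * R) (p : R * R) := (1 <= i)%N ->
  [/\ lo i <= p.1 <= hi i, lo i <= p.2 <= hi i, `|p.1 - p.2| <= c / i%:R,
    d <= `|f p.1 - f p.2| & forall (a : nat -> R) s,
    slack i * `|psum (E \o u) a i| <= slack i.+1 * `|psum (E \o u) a i + s *: E p|].
have unitE p : d <= `|f p.1 - f p.2| -> `|E p| = 1.
  by move=> dp; apply: norm_unit_vector; exact: lt_le_trans dp.
have mono n u : (forall i, (i < n)%N -> P i u (u i)) -> forall m a, (1 <= m < n)%N ->
    slack m * `|psum (E \o u) a m| <= slack m.+1 * `|psum (E \o u) a m.+1|.
  move=> Pu m a /andP[m1 mn]; rewrite psumS//.
  by have [_ _ _ _] := Pu m mn m1; apply.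
have [||u uP] := @strong_recursion _ (0, 0) P.
- move=> n u v p uv Pp n1; have [p1 p2 pc pd pa] := Pp n1; split => // a s.
  by rewrite -(@psum_eq (E \o u))// => i /uv /= ->.
- move=> n u Pu.
  have [->|n1] := posnP n; first by exists (0, 0).
  have on := dyadic_offset_lt n1.
  have slack0 : 0 < slack n.+1 by rewrite (lt_le_trans _ (slack_ge1 _)).
  have lohi : phi (lo n) < phi (hi n).
    rewrite /lo /hi !phiq ?frac01 ?(ltnW on)// ltr_pM2l//.
    by rewrite ltr_pM2r ?invr_gt0 ?exprn_gt0// ltr_nat.
  (* The tolerance is chosen so that the factor left is the ratio of consecutive slacks. *)
  have [||||||||t [t' [tlh t'lh tt' dtt' sel]]] := @select_increment _ _ f d phi (E \o u) n 2
    (lo n) (hi n) (1 - slack n / slack n.+1) (c / n%:R) fint d0 mass.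
  + by move=> i /andP[i1 iN]; apply: unitE; have [] := Pu i iN i1.
  + by move=> a k kn; apply: (slack_projections (mono _ _ Pu)).
  + by have /andP[] := q01 _ (frac01 _ _ (ltnW on)).
  + by rewrite ltNge; apply/negP => /phi_homo; rewrite leNgt lohi.
  + by have /andP[] := q01 _ (frac01 _ _ on).
  + exact: lohi.
  + by rewrite subr_gt0 ltr_pdivrMr// mul1r slack_lt.
  + by rewrite divr_gt0// ltr0n.
  exists (t, t') => _; split => // a s.
  by rewrite [leRHS]mulrC -ler_pdivrMr// mulrAC; have := sel a s; rewrite opprB addrC subrK.
pose e := E \o u.
have ne : normalized e by move=> i i1; apply: unitE; have [] := uP i i1.
exists e; split => //.
  apply: (@basic_sequence_of_projections _ _ e 2) => // a n m nm.
  by apply: (slack_projections (mono _ _ _) a nm (leqnn m)) => i _; exact: uP.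
move=> eps eps0.
(* The factor [phi 1] is the total length of [2 ^ m] cells of length [c / 2 ^ m]. *)
have [delta delta0 fd] := riemann_unit_cells fint d0 (mulr_gt0 eps0 phi1).
have [n0 n0P] := @geometric_small R c (delta / 2) (divr_gt0 delta0 (ltr0n _ 2)).
exists n0 => r [m [g [n0m gA ->]]].
pose l := c / 2 ^+ m.
have l0 : 0 < l by rewrite divr_gt0 ?exprn_gt0.
have ld : l < delta.
  by rewrite (le_lt_trans (n0P _ n0m))// gtr_pMr// invf_lt1 ?ltr1n.
pose Q (j : nat) := q (j%:R / 2 ^+ m).
(* An interval of mass [l] has length at least [l], so it has room for the cell. *)
have Ql j : (j < 2 ^ m)%N -> l <= Q j.+1 - Q j.
  move=> jm; rewrite (le_trans _ (phi_lip _ _ _))//; last first.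
    have /andP[f0 _] := frac01 m j (ltnW jm); have /andP[_ f1] := frac01 m j.+1 jm.
    by apply: qle => //; exact: frac_le.
  rewrite !phiq ?frac01 ?(ltnW jm)// -mulrBr -mulrBl -natr1 addrAC subrr add0r mul1r.
  by rewrite /l.
have Q_le j k : (j <= k)%N -> (k <= 2 ^ m)%N -> Q j <= Q k.
  move=> jk km; have /andP[f0 _] := frac01 m j (leq_trans jk km).
  by have /andP[_ f1] := frac01 m k km; apply: qle => //; exact: frac_le.
have gQ j : (j < 2 ^ m)%N -> let p := u (g j) in
    [/\ Q j <= p.1 <= Q j.+1, Q j <= p.2 <= Q j.+1, `|p.1 - p.2| <= l &
     d <= `|f p.1 - f p.2|].
  move=> jm p; have [mg Aj] := gA j jm.
  have g1 : (1 <= g j)%N by rewrite (leq_trans _ mg)// expn_gt0.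
  have [p1 p2 pc pd _] := uP (g j) g1.
  have [h [lE oj oj']] := dyadic_haar_bounds mg Aj.
  have scale x : x%:R / 2 ^+ m = (x * 2 ^ h)%N%:R / 2 ^+ dyadic_level (g j) :> R.
    by rewrite lE exprD natrM natrX; field; rewrite !expf_neq0.
  have Qlo : Q j <= lo (g j).
    rewrite /Q /lo scale; apply: qle; [|exact: frac_le|].
      by rewrite divr_ge0 ?exprn_ge0.
    by have /andP[] := frac01 _ _ (ltnW (dyadic_offset_lt g1)).
  have hiQ : hi (g j) <= Q j.+1.
    rewrite /Q /hi; apply: qle; [|rewrite scale; exact: frac_le|].
      by rewrite divr_ge0 ?exprn_ge0.
    by have /andP[] := frac01 _ _ jm.
  split => //.
  - by case/andP: p1 => p1 p1'; rewrite (le_trans Qlo)//= (le_trans p1').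
  - by case/andP: p2 => p2 p2'; rewrite (le_trans Qlo)//= (le_trans p2').
  - rewrite (le_trans pc)// /l ler_pM2l// lef_pV2 ?posrE ?exprn_gt0 ?ltr0n//.
    by rewrite -natrX ler_nat.
(* The cell starts at the smaller point, or earlier if it would otherwise pass [Q j.+1]. *)
pose a j := Num.min (Num.min (u (g j)).1 (u (g j)).2) (Q j.+1 - l).
pose b j := a j + l.
have aQ j : (j < 2 ^ m)%N -> Q j <= a j.
  move=> jm; have [/andP[p1 _] /andP[p2 _] _ _] := gQ j jm.
  by rewrite /a !le_min p1 p2; have := Ql j jm; lra.
have bQ j : b j <= Q j.+1 by rewrite /b -lerBrDr ge_min lexx orbT.
have := fd (2 ^ m)%N xpredT a b (fun j => (u (g j)).1) (fun j => (u (g j)).2).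
have -> : \sum_(k < 2 ^ m) (b k - a k) *: unit_vector (f (u (g k)).1 - f (u (g k)).2) =
    l *: \sum_(0 <= j < 2 ^ m) e (g j).
  by rewrite big_mkord scaler_sumr; apply: eq_bigr => k _; rewrite /b addrAC subrr add0r.
rewrite normrZ gtr0_norm// /l -mulrA [_ * c]mulrC ler_pM2l//; apply.
- move=> k km; split.
  + by rewrite (le_trans _ (aQ k km))//; have /andP[] := q01 _ (frac01 m k (ltnW km)).
  + by rewrite /b ltrDl.
  + by rewrite (le_trans (bQ k))//; have /andP[] := q01 _ (frac01 m k.+1 km).
  + by rewrite /b addrAC subrr add0r.
- by move=> k k' kk' k'm; rewrite (le_trans (bQ k))// (le_trans _ (aQ k' k'm))// Q_le// ltnW.
- move=> k km _; have [/andP[p1 p1'] /andP[p2 p2'] + dp] := gQ k km.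
  rewrite ler_norml => /andP[pl pl'].
  rewrite /b /a; split => //.
    by rewrite ge_min ge_min lexx /= -lerBlDr !le_min; lra.
  by rewrite ge_min ge_min lexx orbT /= -lerBlDr !le_min; lra.
Qed.

End HaarSequence.

(** * The oscillation of a function *)

Section OscillationMass.
Context {R : realType} {X : normedModType R}.
Implicit Types (f : R -> X).

Definition small_oscillation f (d : R) : set R :=
  [set u | exists2 eta : R, 0 < eta & forall t t', 0 < t < 1 -> 0 < t' < 1 ->
    `|u - t| < eta -> `|u - t'| < eta -> `|f t - f t'| < d].

Lemma open_small_oscillation f d : open (small_oscillation f d).
Proof.
rewrite openE => u [eta eta0 ud]; apply/nbhs_ballP.
exists (eta / 2) => /=; first by rewrite divr_gt0.
move=> v uv; have {}uv : `|u - v| < eta / 2 := uv.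
exists (eta / 2) => [|t t' t01 t'01 vt vt']; first by rewrite divr_gt0.
apply: ud => //.
  by rewrite (le_lt_trans (ler_distD v _ _))// [ltRHS]splitr ltrD.
by rewrite (le_lt_trans (ler_distD v _ _))// [ltRHS]splitr ltrD.
Qed.

Definition oscillation_set f d : set R := `]0, 1[%classic `\` small_oscillation f d.

Lemma measurable_oscillation_set f d : measurable (oscillation_set f d).
Proof.
apply: measurableD; first exact: measurable_itv.
by apply: measurable_realfun.open_measurable; exact: open_small_oscillation.
Qed.

Lemma continuous_small_oscillation f (u : R) : 0 < u < 1 ->
  (forall n : nat, small_oscillation f n.+1%:R^-1 u) ->
  f v @[v --> within `[0, 1]%classic (nbhs u)] --> f u.
Proof.
move=> u01 small; apply/cvgrPdist_lt => eps eps0.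
have [eta eta0 ud] := small (Num.truncn eps^-1).
have [u0 u1] := andP u01.
rewrite near_withinE; apply/nbhs_ballP.
exists (Num.min eta (Num.min u (1 - u))) => /=.
  by rewrite !lt_min eta0 u0 subr_gt0.
move=> v uv _; have {}uv : `|u - v| < Num.min eta (Num.min u (1 - u)) := uv.
move: uv; rewrite !lt_min => /and3P[uve uv0 uv1].
rewrite (@lt_le_trans _ _ (Num.truncn eps^-1).+1%:R^-1)//.
  apply: ud => //; last by rewrite subrr normr0.
  by move: uv0 uv1; rewrite !ltr_norml; lra.
by rewrite invf_ple ?posrE// ltW// truncnS_gt.
Qed.

(** A discontinuity in [[0, 1]] is an endpoint or lies in one of countably many oscillation sets,
    with [d] the inverse of a positive integer; these cannot all be null. *)
Lemma oscillation_set_pos f :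
  ~ {ae @lebesgue_measure R, forall t : R, `[0, 1]%classic t ->
      f u @[u --> within `[0, 1]%classic (nbhs t)] --> f t} ->
  exists2 d : R, 0 < d & (0 < lebesgue_measure (oscillation_set f d))%E.
Proof.
move=> nae; apply: contrapT => npos; apply: nae.
have null n : (@lebesgue_measure R).-negligible (oscillation_set f n.+1%:R^-1).
  exists (oscillation_set f n.+1%:R^-1); split => //.
    exact: measurable_oscillation_set.
  apply/eqP; rewrite eq_le measure_ge0 andbT leNgt; apply/negP => pos.
  by apply: npos; exists n.+1%:R^-1.
have null01 : (@lebesgue_measure R).-negligible [set 0; 1].
  exists [set 0; 1]; split => //; first by apply: measurableU.
  by apply: countable_lebesgue_measure0; exact: finite_set_countable.
have := negligibleU null01 (negligible_bigcup null).
apply: negligibleS => t /= /not_implyP[+ ndisc].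
rewrite in_itv/= => /andP[t0 t1].
have [t0'|nt0] := eqVneq t 0; first by left; left.
have [t1'|nt1] := eqVneq t 1; first by left; right.
have t01 : 0 < t < 1 by rewrite !lt_neqAle eq_sym nt0 t0 nt1 t1.
right; apply: contrapT => nE; apply: ndisc.
apply: continuous_small_oscillation => // n; apply: contrapT => ns.
by apply: nE; exists n => //; split => //=; rewrite in_itv.
Qed.

(** Here [phi x] is the measure of the part of the oscillation set up to [x]. *)
Lemma oscillation_mass_exists f :
  ~ {ae @lebesgue_measure R, forall t : R, `[0, 1]%classic t ->
      f u @[u --> within `[0, 1]%classic (nbhs t)] --> f t} ->
  exists d phi, 0 < d /\ oscillation_mass f d phi.
Proof.
move=> /oscillation_set_pos[d d0 Epos].
pose E := oscillation_set f d.
have mE : measurable E by exact: measurable_oscillation_set.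
pose mu := @lebesgue_measure R.
pose F x := E `&` `]-oo, x]%classic.
have mF x : measurable (F x) by apply: measurableI.
have le_mu (A B : set R) : measurable A -> measurable B -> A `<=` B ->
    (mu A <= mu B)%E.
  by move=> mA mB AB; apply: le_measure => //; rewrite inE.
have F01 x : F x `<=` `]0, 1[%classic by move=> u [[]].
have Ffin x : mu (F x) \is a fin_num.
  rewrite ge0_fin_numE ?measure_ge0//.
  rewrite (@le_lt_trans _ _ (mu `]0, 1[%classic))//.
    exact: le_mu.
  by rewrite /mu lebesgue_measure_itv/= lte_fin ltr01 oppr0 adde0 ltry.
have FU x y A : measurable A -> F y `<=` F x `|` A -> (mu (F y) <= mu (F x) + mu A)%E.
  move=> mA sub; rewrite (@le_trans _ _ (mu (F x `|` A)))//.
    by apply: le_mu => //; exact: measurableU.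
  by apply: measureU2; [exact: mF|exact: mA].
exists d, (fun x => fine (mu (F x))); split => //; split.
- move=> x y xy; apply: fine_le => //; apply: le_mu => // u [Eu].
  by rewrite /= !in_itv/= => ux; split => //; rewrite /= in_itv/= (le_trans ux).
- move=> x y xy; rewrite lerBlDl -lee_fin EFinD !fineK//.
  rewrite (le_trans (@FU x y `]x, y]%classic _ _))//.
    move=> u [Eu]; rewrite /= in_itv/= => uy.
    have [ux|xu] := leP u x; first by left; split => //; rewrite /= in_itv.
    by right; rewrite /= in_itv/= xu.
  rewrite leeD2l// /mu lebesgue_measure_itv/= lte_fin; case: ifPn => // _.
  by rewrite lee_fin subr_ge0.
- have -> : F 0 = set0.
    rewrite -subset0 => u [[+ _]].
    by rewrite /= !in_itv/= => /andP[u0 _] u0'; move: u0; rewrite ltNge u0'.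
  by rewrite /mu measure0.
- rewrite -lte_fin fineK//; apply: (lt_le_trans Epos).
  apply: le_mu => // u Eu; split => //.
  by case: Eu => + _; rewrite /= !in_itv/= => /andP[_ /ltW].
- move=> x y x0 xy y1 phixy.
  (* Otherwise [E] gains at most the null set of the single point [y] between [x] and [y]. *)
  have [u [Eu xu uy]] : exists u, [/\ E u, x < u & u < y].
    apply: contrapT => nu; move: phixy; apply/negP; rewrite -leNgt -lee_fin !fineK//.
    rewrite -[leRHS]adde0 -[X in (_ <= _ + X)%E](@lebesgue_measure_set1 R y).
    apply: FU => // u [Eu]; rewrite /= in_itv/= le_eqVlt => /predU1P[->|uy]; first by right.
    left; split => //; rewrite /= in_itv/= leNgt; apply/negP => xu.
    by apply: nu; exists u.
  case: Eu => _ nsmall; apply: contrapT => ntt; apply: nsmall.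
  exists (Num.min (u - x) (y - u)) => [|t t' _ _]; first by rewrite lt_min !subr_gt0 xu.
  rewrite !lt_min => /andP[t1 t2] /andP[t1' t2']; rewrite ltNge; apply/negP => dtt.
  apply: ntt; exists t, t'; split => //.
    by move: t1 t2; rewrite !ltr_norml; lra.
  by move: t1' t2'; rewrite !ltr_norml; lra.
Qed.

End OscillationMass.

(** * Haar systems with small averages *)

Section HaarNull.
Context {R : realType} {X : normedModType R}.
Implicit Types (e : nat -> X) (A : nat -> nat -> set nat).

Lemma haar_averages_le1 e A n r : normalized e -> haar_averages e A n r -> r <= 1.
Proof.
move=> ne [m [i [_ iA ->]]]; rewrite mulrC ler_pdivrMr ?exprn_gt0// mul1r.
rewrite big_mkord (le_trans (ler_norm_sum _ _ _))//.
rewrite (eq_bigr (fun=> 1)); first by rewrite sumr_const card_ord -natrX.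
move=> j _; apply: ne; have [ij _] := iA j (ltn_ord j).
by rewrite (leq_trans _ ij)// expn_gt0.
Qed.

Lemma haar_averages_neq0 e A n : haar_system A -> haar_averages e A n !=set0.
Proof.
move=> hA; have [inf _ _ _] := hA n.+1 isT.
have /choice[i iP] j : exists i, (j < 2 ^ n.+1)%N -> (2 ^ n.+1 <= i)%N /\ A n.+1 j i.
  have [jn|nj] := ltnP j (2 ^ n.+1); last by exists 0%N.
  by have [i Ai ni] := (infinite_natP _).1 (inf j jn) (2 ^ n.+1)%N; exists i.
by eexists; exists n.+1, i; split; [exact: leqnSn|exact: iP|reflexivity].
Qed.

(** The suprema decrease to a limit; if it were positive, the maximum of 1 and its inverse would
    serve as [C]. *)
Lemma haar_averages_null e A : normalized e -> haar_system A ->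
  ~ (exists2 C : R, 1 <= C & C^-1 <= limn (fun n => sup (haar_averages e A n))) ->
  forall eps : R, 0 < eps -> exists n, forall r, haar_averages e A n r -> r <= eps.
Proof.
move=> ne hA nC eps eps0.
pose s n := sup (haar_averages e A n).
have ub n : has_ubound (haar_averages e A n) by exists 1 => r; exact: haar_averages_le1.
have s0 n : 0 <= s n.
  have [r rA] := haar_averages_neq0 e n hA.
  by rewrite (le_trans (haar_averages_ge0 rA))//; exact: ub_le_sup.
have sdec : {homo s : n m / (n <= m)%N >-> m <= n}.
  move=> n m nm; apply: ge_sup; first exact: haar_averages_neq0.
  move=> r [k [i [mk iA rE]]]; apply: ub_le_sup => //.
  by exists k, i; split => //; exact: leq_trans mk.
have cs : cvgn s.
  by apply: nonincreasing_is_cvgn => //; exists 0 => _ [n _ <-].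
have L0 : limn s <= 0.
  rewrite leNgt; apply/negP => Lpos; apply: nC.
  exists (Num.max 1 (limn s)^-1); first by rewrite le_max lexx.
  rewrite invf_ple ?posrE// ?le_max ?lexx ?orbT//.
  by rewrite lt_max ltr01.
have /cvgrPdist_le/(_ _ eps0)[n _ nP] := cs.
exists n => r rA; rewrite (@le_trans _ _ (s n))//; first exact: ub_le_sup.
by have := nP n (leqnn n); rewrite ler_norml; lra.
Qed.

End HaarNull.

(** * Tags in nested dyadic intervals, and total lengths of cells *)

Section HaarTags.
Context {R : realType}.
Implicit Types (A : nat -> nat -> set nat).

Lemma haar_ancestor A m h j i : haar_system A -> (1 <= m)%N -> (j < 2 ^ (m + h))%N ->
  A (m + h)%N j i -> A m (j %/ 2 ^ h)%N i.
Proof.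
move=> hA m1; elim: h j => [|h IH] j; first by rewrite addn0 divn1.
rewrite addnS => jm Aj; rewrite expnS mulnC divnMA -divnMA mulnC divnMA.
have j2 : (j %/ 2 < 2 ^ (m + h))%N by rewrite ltn_divLR// mulnC -expnS.
apply: IH => //; have [_ _ _ /(_ _ j2) ->] := hA (m + h)%N (leq_trans m1 (leq_addr _ _)).
have : j = (2 * (j %/ 2))%N \/ j = (2 * (j %/ 2)).+1 by lia.
by move=> [E|E]; [left|right]; rewrite -E.
Qed.

(** The tag is the midpoint of the dyadic interval of [i] at the last level [m] with [2 ^ m <= i].
    Nesting gives the coarser levels, and a midpoint makes the inequalities strict. *)
Lemma haar_tags A : haar_system A -> exists tag : nat -> R,
  forall m j i, (1 <= m)%N -> (j < 2 ^ m)%N -> (2 ^ m <= i)%N -> A m j i ->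
  j%:R / 2 ^+ m < tag i < j.+1%:R / 2 ^+ m.
Proof.
move=> hA.
have /choice[c cP] i : exists j, (2 <= i)%N ->
    (j < 2 ^ trunc_log 2 i)%N /\ A (trunc_log 2 i) j i.
  have [i2|] := leqP 2 i; last by exists 0%N.
  have k1 : (1 <= trunc_log 2 i)%N by rewrite trunc_log_gt0.
  have [_ cov _ _] := hA _ k1.
  have : [set i | (1 <= i)%N] i by rewrite /= ltnW.
  by rewrite -cov => -[j jk Aj]; exists j.
exists (fun i => ((c i)%:R + 2^-1) / 2 ^+ trunc_log 2 i) => m j i m1 jm mi Aj.
have i2 : (2 <= i)%N by rewrite (leq_trans _ mi)// -[X in (X <= _)%N]expn1 leq_exp2l.
have [ck Ac] := cP i i2.
have mk : (m <= trunc_log 2 i)%N by apply: trunc_log_max.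
move: ck Ac; rewrite -(subnKC mk); move: (trunc_log 2 i - m)%N => h ck Ac.
have Am := haar_ancestor hA m1 ck Ac.
have jE : j = (c i %/ 2 ^ h)%N.
  apply: contrapT => jne; have [_ _ disj _] := hA m m1.
  have cm : (c i %/ 2 ^ h < 2 ^ m)%N by rewrite ltn_divLR ?expn_gt0// -expnD.
  have : (A m j `&` A m (c i %/ 2 ^ h)%N) i by [].
  by rewrite disj.
have lo : (j * 2 ^ h <= c i)%N by rewrite jE leq_divM.
have hi : ((c i).+1 <= j.+1 * 2 ^ h)%N by rewrite jE -ltn_divLR ?expn_gt0.
have scale x : x%:R / 2 ^+ m = (x * 2 ^ h)%N%:R / 2 ^+ (m + h) :> R.
  by rewrite exprD natrM natrX; field; rewrite !expf_neq0.
rewrite !scale !ltr_pM2r ?invr_gt0 ?exprn_gt0//.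
move: lo hi; rewrite -!(ler_nat R) -natr1.
by move: ((c i)%:R) ((j * 2 ^ h)%:R) ((j.+1 * 2 ^ h)%:R) => x y z; lra.
Qed.

(** Clamping all points to [[a, b]] preserves the cells counted and makes the total telescope. *)
Lemma clamped_cells (p : nat -> R) (n : nat) (a b : R) : a <= b ->
  (forall i, (i < n)%N -> p i <= p i.+1) ->
  \sum_(i < n | (a <= p i) && (p i.+1 <= b)) (p i.+1 - p i) <= b - a.
Proof.
move=> ab pS; pose c x := Num.max a (Num.min x b).
have c_homo x y : x <= y -> c x <= c y.
  move=> xy; rewrite /c ge_max le_max lexx /= le_max; apply/orP; right.
  by rewrite le_min !ge_min xy lexx orbT.
rewrite (@le_trans _ _ (\sum_(i < n) (c (p i.+1) - c (p i))))//.
  rewrite big_mkcond/=; apply: ler_sum => i _; case: ifPn => [/andP[api pib]|_].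
    have pi := pS i (ltn_ord i).
    by rewrite /c !min_l ?(le_trans pi)// !max_r// (le_trans api).
  by rewrite subr_ge0 c_homo// pS.
rewrite -(big_mkord xpredT (fun i => c (p i.+1) - c (p i))) telescope_sumr//.
by rewrite lerB// /c ?le_max ?lexx// ge_max ab ge_min lexx orbT.
Qed.

End HaarTags.

(** * The function attached to a Haar system *)

Section HaarFunction.
Context {R : realType} {X : completeNormedModType R}.
Implicit Types (e : nat -> X) (A : nat -> nat -> set nat) (f : R -> X).

(** With coefficients that count multiplicities, a sum of chosen vectors becomes a partial sum, to
    which projection bounds apply. *)
Lemma psum_count e (g : nat -> nat) (M N : nat) : (forall j, (j < M)%N -> (1 <= g j)%N) ->
  psum e (fun i => \sum_(j < M | g j == i) 1) N = \sum_(j < M | (g j < N)%N) e (g j).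
Proof.
move=> g1; rewrite /psum; under eq_bigr do rewrite scaler_suml.
rewrite (exchange_big_dep xpredT)//= [RHS]big_mkcond/=; apply: eq_bigr => j _.
rewrite (eq_bigr e) => [|i _]; last exact: scale1r.
case: ifPn => gN.
  rewrite big_mkcond/= (bigD1_seq (g j)) ?iota_uniq ?mem_index_iota ?g1//= eqxx.
  by rewrite big1 ?addr0// => i /negPf; rewrite eq_sym => ->.
rewrite big_nat_cond big1// => i /andP[/andP[_ iN] /eqP gi].
by move: gN; rewrite gi iN.
Qed.

(* The missing indices are chosen so large that the given partial sum is a
   basis projection of the completed one. *)
Lemma partial_haar_average e A (K eps : R) (m : nat) (v : nat -> X) : haar_system A ->
  (1 <= m)%N -> (forall a n k, (n <= k)%N -> `|psum e a n| <= K * `|psum e a k|) ->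
  0 <= K -> (forall r, haar_averages e A m r -> r <= eps) ->
  (forall j, (j < 2 ^ m)%N -> v j = 0 \/ exists i, [/\ (2 ^ m <= i)%N, A m j i & v j = e i]) ->
  `|\sum_(j < 2 ^ m) v j| <= K * (2 ^+ m * eps).
Proof.
move=> hA m1 eK K0 small vP.
have [Ainf _ _ _] := hA m m1.
(* Index 0 marks a zero term; genuine indices are at least [2 ^ m]. *)
have /choice[ii iiP] j : exists i, (j < 2 ^ m)%N -> (v j = 0 /\ i = 0%N) \/
    [/\ (2 ^ m <= i)%N, A m j i & v j = e i].
  have [jm|mj] := ltnP j (2 ^ m); last by exists 0%N.
  have [v0|[i iP]] := vP j jm; first by exists 0%N; left.
  by exists i; right.
pose N := (\max_(j < 2 ^ m) ii j).+1.
have iiN j : (j < 2 ^ m)%N -> (ii j < N)%N.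
  by move=> jm; rewrite ltnS (leq_bigmax (Ordinal jm)).
have /choice[far farP] j : exists i, (j < 2 ^ m)%N ->
    [/\ (2 ^ m <= i)%N, A m j i & (N <= i)%N].
  have [jm|mj] := ltnP j (2 ^ m); last by exists 0%N.
  have [i Ai] := (infinite_natP _).1 (Ainf j jm) (maxn (2 ^ m) N).
  by rewrite geq_max => /andP[mi Ni]; exists i.
pose g j := if ii j == 0%N then far j else ii j.
have gP j : (j < 2 ^ m)%N -> (2 ^ m <= g j)%N /\ A m j (g j).
  move=> jm; rewrite /g; case: eqP => i0; first by have [] := farP j jm.
  by case: (iiP j jm) => -[].
have g1 j : (j < 2 ^ m)%N -> (1 <= g j)%N.
  by move=> /gP[gm _]; rewrite (leq_trans _ gm)// expn_gt0.
pose M := maxn N (\max_(j < 2 ^ m) g j).+1.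
have gM j : (j < 2 ^ m)%N -> (g j < M)%N.
  by move=> jm; rewrite leq_max ltnS (leq_bigmax (Ordinal jm)) orbT.
have -> : \sum_(j < 2 ^ m) v j = psum e (fun i => \sum_(j < 2 ^ m | g j == i) 1) N.
  rewrite psum_count// [RHS]big_mkcond/=; apply: eq_bigr => j _.
  rewrite /g; case: eqP => i0; case: (iiP j (ltn_ord j)) => -[]//.
  - by move=> -> _; have [_ _ Nf] := farP j (ltn_ord j); rewrite ltnNge Nf.
  - by rewrite i0 leqn0 expn_eq0.
  - by move=> _ _ ->; rewrite iiN.
rewrite (le_trans (eK _ N M (leq_maxl _ _)))// ler_wpM2l// psum_count//.
rewrite (eq_bigl xpredT) => [|j]; last by rewrite gM.
rewrite mulrC -ler_pdivrMr ?exprn_gt0// mulrC.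
by apply: small; exists m, g; split => //; rewrite big_mkord.
Qed.

(* Tags may coincide: which of the corresponding vectors is taken is immaterial. *)
Lemma haar_function e (tag : nat -> R) : exists (f : R -> X) (g : R -> nat), forall t,
  (f t = 0 /\ forall i, (2 <= i)%N -> tag i <> t) \/
  [/\ (2 <= g t)%N, tag (g t) = t & f t = e (g t)].
Proof.
have /choice[fg fgP] t : exists p : X * nat,
    (p.1 = 0 /\ forall i, (2 <= i)%N -> tag i <> t) \/
    [/\ (2 <= p.2)%N, tag p.2 = t & p.1 = e p.2].
  have [[i [i2 ti]]|nt] := pselect (exists i, (2 <= i)%N /\ tag i = t).
    by exists (e i, i); right.
  by exists (0, 0%N); left; split => // i i2 ti; apply: nt; exists i.
by exists (fun t => (fg t).1), (fun t => (fg t).2) => t; exact: fgP.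
Qed.

Section Tags.
Context (e : nat -> X) (A : nat -> nat -> set nat) (tag : nat -> R).
Context (f : R -> X) (g : R -> nat).
Context (ne : normalized e) (hA : haar_system A).
Context (tagP : forall m j i, (1 <= m)%N -> (j < 2 ^ m)%N -> (2 ^ m <= i)%N -> A m j i ->
  j%:R / 2 ^+ m < tag i < j.+1%:R / 2 ^+ m).
Context (fP : forall t, (f t = 0 /\ forall i, (2 <= i)%N -> tag i <> t) \/
  [/\ (2 <= g t)%N, tag (g t) = t & f t = e (g t)]).

Lemma haar_function_le1 t : `|f t| <= 1.
Proof.
case: (fP t) => [[-> _]|[g2 _ ->]]; first by rewrite normr0.
by rewrite ne// ltnW.
Qed.

Lemma haar_function_tag i : (2 <= i)%N -> `|f (tag i)| = 1.
Proof.
move=> i2; case: (fP (tag i)) => [[_ /(_ i i2)]//|[g2 _ ->]].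
by rewrite ne// ltnW.
Qed.

Lemma haar_tags_dense (t eta : R) : 0 <= t <= 1 -> 0 < eta ->
  exists2 i, (2 <= i)%N & 0 < tag i < 1 /\ `|t - tag i| < eta.
Proof.
move=> /andP[t0 t1] eta0.
have [n nP] := geometric_small 1 (divr_gt0 eta0 (ltr0n R 2)).
pose m := n.+1; have mP := nP m (leqnSn n).
have M0 : 0 < 2 ^+ m :> R by rewrite exprn_gt0.
have [j [jm jt tj]] : exists j : nat, [/\ (j < 2 ^ m)%N, j%:R / 2 ^+ m <= t &
    t <= j.+1%:R / 2 ^+ m].
  (* The point 1 is assigned to the last interval, since truncation would give [2 ^ m]. *)
  have [->|t1'] := eqVneq t 1.
    have E : (2 ^ m)%N = (2 ^ m).-1.+1 by rewrite prednK// expn_gt0.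
    exists (2 ^ m).-1; split.
    - by rewrite [X in (_ < X)%N]E.
    - by rewrite ler_pdivrMr// mul1r -natrX ler_nat leq_pred.
    - by rewrite -E natrX divff ?gt_eqF.
  have tM : 0 <= t * 2 ^+ m by rewrite mulr_ge0// ltW.
  have /andP[j1 j2] := truncn_itv tM.
  exists (Num.truncn (t * 2 ^+ m)); split.
  - by rewrite -(ltr_nat R) natrX (le_lt_trans j1)// gtr_pMl// lt_neqAle t1' t1.
  - by rewrite ler_pdivrMr.
  - by rewrite ler_pdivlMr// ltW.
have [Ainf _ _ _] := hA (ltn0Sn n : (1 <= m)%N).
have [i Ai mi] := (infinite_natP _).1 (Ainf j jm) (2 ^ m)%N.
have /andP[ti it] := tagP (ltn0Sn n) jm mi Ai.
exists i.
  by rewrite (leq_trans _ mi)// -[X in (X <= _)%N]expn1 leq_exp2l.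
have j0 : 0 <= j%:R / 2 ^+ m :> R by rewrite divr_ge0// ltW.
have j1 : j.+1%:R / 2 ^+ m <= 1 :> R by rewrite ler_pdivrMr// mul1r -natrX ler_nat.
have jj : j.+1%:R / 2 ^+ m = j%:R / 2 ^+ m + 1 / 2 ^+ m :> R by rewrite -mulrDl natr1.
split; first by rewrite (le_lt_trans j0)//= (lt_le_trans it).
move: ti it jt tj mP; rewrite jj ltr_norml; set x := _ / _; set y := 1 / _; lra.
Qed.

(** Near every point [f] has values of norm 1, at tags, and the value 0, since the countably many
    tags cannot fill an interval. *)
Lemma haar_function_discontinuous (t : R) : 0 <= t <= 1 ->
  ~ (f u @[u --> within `[0, 1]%classic (nbhs t)] --> f t).
Proof.
move=> t01 /cvgrPdist_lt /(_ 2^-1); rewrite invr_gt0 ltr0n => /(_ isT).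
rewrite near_withinE => /nbhs_ballP[eta /= eta0 tf].
have {}tf u : 0 <= u <= 1 -> `|t - u| < eta -> `|f t - f u| < 2^-1.
  by move=> u01 tu; apply: tf => //; rewrite /= in_itv.
have [i i2 [/andP[i0 i1] ti]] := haar_tags_dense t01 eta0.
(* Points between [lo] and [tag i] stay in [[0, 1]] and within [eta] of [t]. *)
pose lo := Num.max 0 (tag i - (eta - `|t - tag i|)).
have lotag : lo < tag i by rewrite gt_max i0/= gtrBl subr_gt0.
have [u [lou utag ut]] : exists u, [/\ lo < u, u < tag i & forall k, tag k <> u].
  apply: contrapT => nu.
  have sub : `]lo, tag i[%classic `<=` range tag.
    move=> u; rewrite /= in_itv/= => /andP[lou utag]; apply: contrapT => nr.
    by apply: nu; exists u; split => // k ku; apply: nr; exists k.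
  have : lebesgue_measure (`]lo, tag i[%classic : set R) = 0%E.
    apply: countable_lebesgue_measure0; apply: sub_countable (card_image_le tag setT).
    exact: subset_card_le.
  rewrite lebesgue_measure_itv/= lte_fin lotag -EFinB => /eqP.
  by rewrite eqe subr_eq0 gt_eqF.
have fu : f u = 0 by case: (fP u) => [[]//|[_ gu _]]; case: (ut (g u)).
move: lou; rewrite gt_max => /andP[u0 uu].
have tu : `|t - u| < eta.
  rewrite (le_lt_trans (ler_distD (tag i) _ _))//.
  by rewrite (gtr0_norm (x := tag i - u)) ?subr_gt0//; lra.
have u01 : 0 <= u <= 1 by rewrite !ltW// (lt_trans utag).
have i01 : 0 <= tag i <= 1 by rewrite !ltW.
have h1 := tf u u01 tu; have h2 := tf (tag i) i01 ti.
have := ler_distD (f t) (f (tag i)) (f u).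
rewrite fu subr0 haar_function_tag//; move: h1 h2; rewrite fu subr0 distrC; lra.
Qed.

Lemma haar_function_not_ae :
  ~ {ae @lebesgue_measure R, forall t : R, `[0, 1]%classic t ->
      f u @[u --> within `[0, 1]%classic (nbhs t)] --> f t}.
Proof.
move=> [B [mB B0 sub]].
have : (lebesgue_measure (`[0%R, 1%R]%classic : set R) <= lebesgue_measure B)%E.
  apply: le_measure; [by rewrite inE; exact: measurable_itv|by rewrite inE|].
  move=> t; rewrite /= in_itv/= => t01; apply: sub => /= ft.
  by apply: (haar_function_discontinuous t01); apply: ft; rewrite in_itv.
rewrite lebesgue_measure_itv/= lte_fin ltr01 oppr0 adde0 [X in (_ <= X)%E]B0.
by rewrite lee_fin ler10.
Qed.

(** Cells near a dyadic point of level [m] or a tag of index below [2 ^ m] have small total length.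
    Every other cell lies in one dyadic interval, and its value is 0 or an [e i] admissible there,
    so partial averages control their sum. *)
Lemma haar_function_integrable (K : R) : 0 <= K ->
  (forall a n k, (n <= k)%N -> `|psum e a n| <= K * `|psum e a k|) ->
  (forall eps : R, 0 < eps -> exists n, forall r, haar_averages e A n r -> r <= eps) ->
  riemann_integrable f.
Proof.
move=> K0 eK small; exists 0 => eps eps0.
have K1 : 0 < K + 1 by rewrite ltr_wpDl.
have eps1 : 0 < eps / 4 / (K + 1) by rewrite !divr_gt0.
have [n nP] := small _ eps1.
pose m := maxn n 1.
have m1 : (1 <= m)%N by rewrite leq_maxr.
have mP r : haar_averages e A m r -> r <= eps / 4 / (K + 1).
  move=> [k [i [mk iA rE]]]; apply: nP; exists k, i; split => //.
  by rewrite (leq_trans _ mk)// leq_maxl.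
have M0 : 0 < 2 ^+ m :> R by rewrite exprn_gt0.
pose Z := [seq j%:R / 2 ^+ m | j <- iota 0 (2 ^ m).+1] ++ [seq tag i | i <- iota 0 (2 ^ m)].
(* Each point of [Z] spoils cells of total length at most [2 * delta], hence at most [eps / 4]
   altogether. *)
pose delta := eps / 8 / (size Z).+1%:R.
have delta0 : 0 < delta by rewrite !divr_gt0 ?ltr0n.
exists delta => // s t [sp st tI] msh.
pose p i := (0 :: s)`_i.
have pS i : (i < size s)%N -> p i < p i.+1.
  by case: sp => /(pathP 0) path_s _ iS; exact: path_s.
have p_bounds i : (i <= size s)%N -> 0 <= p i <= 1.
  move=> iS; rewrite /p (set_nth_default 1) ?ltnS//.
  by rewrite (itv_partition_nth_ge _ sp)// (itv_partition_nth_le _ sp).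
have cell_lt i : (i < size s)%N -> p i.+1 - p i < delta.
  move=> iS; apply: le_lt_trans msh.
  exact: (le_bigmax _ (fun i : 'I_(size s) => cell_length s i) (Ordinal iS)).
pose bad i := has (fun z => (z - delta <= p i) && (p i.+1 <= z + delta)) Z.
have badP z i : z \in Z -> z - delta <= p i -> p i.+1 <= z + delta -> bad i.
  by move=> zZ zi iz; apply/hasP; exists z => //; rewrite zi.
pose dy i := Num.truncn (2 ^+ m * p i).
pose S j : set X := [set x | x = 0 \/ exists i, [/\ (2 ^ m <= i)%N, A m j i & x = e i]].
have goodP i : (i < size s)%N -> ~~ bad i ->
    [/\ (dy i < 2 ^ m)%N, (dy i)%:R / 2 ^+ m <= p i,
     p i.+1 <= (dy i).+1%:R / 2 ^+ m & S (dy i) (f t`_i)].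
  move=> iS nbad.
  have /andP[p0 _] := p_bounds i (ltnW iS).
  have /andP[_ p1] := p_bounds i.+1 iS.
  have pi := pS i iS; have pd := cell_lt i iS.
  have /andP[d1 d2] := truncn_itv (mulr_ge0 (ltW M0) p0); rewrite -/(dy i) in d1 d2.
  have dm : (dy i < 2 ^ m)%N.
    by rewrite -(ltr_nat R) natrX (le_lt_trans d1)// gtr_pMr// (lt_le_trans pi).
  have lo : (dy i)%:R / 2 ^+ m <= p i by rewrite ler_pdivrMr// mulrC.
  have lo' : p i < (dy i).+1%:R / 2 ^+ m by rewrite ltr_pdivlMr// mulrC.
  have hi : p i.+1 <= (dy i).+1%:R / 2 ^+ m.
    rewrite leNgt; apply: contra nbad => zp.
    apply: (badP ((dy i).+1%:R / 2 ^+ m)); [|lra|lra].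
    by rewrite mem_cat (map_f (fun j : nat => j%:R / 2 ^+ m)) ?mem_iota.
  split => //.
  have /andP[ti it] := tI i iS; rewrite -/(p i) -/(p i.+1) in ti it.
  case: (fP t`_i) => [[-> _]|[g2 tg ->]]; first by left.
  have mg : (2 ^ m <= g t`_i)%N.
    rewrite leqNgt; apply: contra nbad => gm.
    apply: (badP t`_i); [|lra|lra].
    by rewrite mem_cat -tg (map_f tag) ?orbT// mem_iota.
  right; exists (g t`_i); split => //.
  have [_ cov _ _] := hA m1.
  have : [set k | (1 <= k)%N] (g t`_i) by rewrite /= ltnW.
  rewrite -cov => -[l /= lm Al].
  have /andP[lt tl] := tagP m1 lm mg Al; rewrite tg in lt tl.
  suff -> : dy i = l by [].
  have := lt_le_trans lt (le_trans it hi); have := le_lt_trans (le_trans lo ti) tl.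
  rewrite !ltr_pM2r ?invr_gt0// !ltr_nat !ltnS => h1 h2.
  by apply/eqP; rewrite eqn_leq h1.
have cells a b : a <= b ->
    \sum_(i < size s | (a <= p i) && (p i.+1 <= b)) (p i.+1 - p i) <= b - a.
  by move=> ab; apply: clamped_cells => // i iS; rewrite ltW ?pS.
have bad_sum : \sum_(i < size s | bad i) (p i.+1 - p i) <= eps / 4.
  rewrite (@le_trans _ _ (\sum_(z <- Z) \sum_(i < size s |
     (z - delta <= p i) && (p i.+1 <= z + delta)) (p i.+1 - p i)))//.
    under [leRHS]eq_bigr do rewrite big_mkcond/=.
    rewrite exchange_big/= big_mkcond/=; apply: ler_sum => i _.
    have p0 : 0 <= p i.+1 - p i by rewrite subr_ge0 ltW// pS.
    case: ifPn => [/hasP[z zZ zi]|_]; last by apply: sumr_ge0 => z _; case: ifP.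
    by rewrite (big_rem z zZ)/= zi lerDl; apply: sumr_ge0 => z' _; case: ifP.
  rewrite (@le_trans _ _ (\sum_(z <- Z) (delta *+ 2)))//.
    apply: ler_sum => z _; rewrite (le_trans (cells _ _ _))//; lra.
  rewrite big_const_seq count_predT iter_addr_0 -mulrnA -[delta *+ _]mulr_natr natrM.
  have -> : eps / 4 = delta * (2 * (size Z).+1%:R).
    by rewrite /delta; field; rewrite addrC natr1 pnatr_eq0.
  by rewrite ler_pM2l// ler_pM2l// ler_nat.
have good_sum : `|\sum_(i < size s | ~~ bad i) (p i.+1 - p i) *: f t`_i| <= eps / 4.
  pose y j := \sum_(i < size s | ~~ bad i && (dy i == j)) (p i.+1 - p i) *: f t`_i.
  have -> : \sum_(i < size s | ~~ bad i) (p i.+1 - p i) *: f t`_i =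
      \sum_(j < 2 ^ m) y j.
    rewrite (exchange_big_dep (fun i : 'I_(size s) => ~~ bad i))/=; last first.
      by move=> j i _ /andP[].
    apply: eq_bigr => i nbi; have [dm _ _ _] := goodP i (ltn_ord i) nbi.
    rewrite (eq_bigl (pred1 (Ordinal dm))) ?big_pred1_eq// => j.
    by rewrite nbi /= eq_sym.
  have yE : 2 ^+ m *: \sum_(j < 2 ^ m) y j = \sum_(j < 2 ^ m) 2 ^+ m *: y j.
    by rewrite scaler_sumr.
  (* Good cells of the [j]-th interval have total length at most the inverse of [2 ^ m], so the
     rescaled [y j] is a combination of elements of [S j] with weights of sum at most 1. *)
  have main : `|0 + \sum_(j < 2 ^ m) 2 ^+ m *: y j| <= K * (2 ^+ m * (eps / 4 / (K + 1))).
    apply: (in_hull_sum (S := S) (y := fun j => 2 ^+ m *: y j)) => [j jm|v Sv]; last first.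
      by rewrite add0r; apply: (partial_haar_average hA m1 eK K0 mP).
    rewrite /y scaler_sumr; under eq_bigr do rewrite scalerA.
    apply: in_hull_wsum; first by left.
    - by move=> i _; rewrite mulr_ge0 ?(ltW M0)// subr_ge0 ltW// pS.
    - move=> i /andP[nbi /eqP dj]; right.
      by have [_ _ _] := goodP i (ltn_ord i) nbi; rewrite dj.
    - rewrite -mulr_sumr mulrC -ler_pdivlMr// mul1r.
      rewrite (@le_trans _ _ (j.+1%:R / 2 ^+ m - j%:R / 2 ^+ m))//; last first.
        by rewrite -mulrBl -natr1 addrAC subrr add0r mul1r.
      apply: le_trans (cells _ _ _); last by rewrite ler_pM2r ?invr_gt0// ler_nat.
      rewrite big_mkcond [leRHS]big_mkcond/=; apply: ler_sum => i _.
      have p0 : 0 <= p i.+1 - p i by rewrite subr_ge0 ltW// pS.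
      case: ifPn => [/andP[nbi /eqP dj]|_]; last by case: ifP.
      by have [_ lo hi _] := goodP i (ltn_ord i) nbi; rewrite -dj lo hi.
  move: main; rewrite add0r -yE normrZ gtr0_norm// [K * _]mulrCA ler_pM2l// => /le_trans.
  by apply; rewrite mulrCA ger_pMr ?divr_gt0// ler_pdivrMr// mul1r lerDl.
rewrite sub0r normrN /riemann_sum /cell_length.
rewrite (bigID (fun i : 'I_(size s) => bad i))/=.
rewrite (le_lt_trans (ler_normD _ _))// (@le_lt_trans _ _ (eps / 4 + eps / 4))//; last lra.
rewrite lerD// (le_trans (ler_norm_sum _ _ _))// (le_trans _ bad_sum)// ler_sum// => i _.
have p0 : 0 < p i.+1 - p i by rewrite subr_gt0 pS.
by rewrite normrZ gtr0_norm// ger_pMr// haar_function_le1.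
Qed.

End Tags.
End HaarFunction.

Theorem theorem3p1 (R : realType) (X : completeNormedModType R) :
  lebesgue_property X <->
  (forall e : nat -> X, normalized e -> basic_sequence e -> haar_l1_plus e).
Proof.
split=> [LX e ne be|allH f fint].
  (* Without a constant, the averages along [A] tend to 0, and the attached function is integrable
     but nowhere continuous. *)
  split=> // A hA; apply: contrapT => nC.
  have [tag tagP] := @haar_tags R A hA.
  have [f [g fP]] := haar_function e tag.
  have [K eK] := basis_projections ne be.
  apply: (haar_function_not_ae ne hA tagP fP); apply: LX.
  apply: (haar_function_integrable ne hA tagP fP (normr_ge0 K)).
    by move=> a n k nk; rewrite (le_trans (eK a n k nk))// ler_wpM2r// ler_norm.
  exact: haar_averages_null.
(* Failure of almost everywhere continuity yields a basic sequence whose averages along the dyadic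
   Haar system tend to 0, against the positive lower bound [C^-1]. *)
apply: contrapT => /oscillation_mass_exists[d [phi [d0 mass]]].
have [e [ne be small]] := haar_null_sequence fint d0 mass.
have [_ _ /(_ _ haar_system_dyadic)[C C1]] := allH e ne be.
by rewrite haar_averages_lim0// leNgt invr_gt0 (lt_le_trans ltr01 C1).
Qed.
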